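(* Let $\pi\colon\mathbb{R}\to\mathbb{R}$ be a minimal valid function (for a fixed $f\in\mathbb{R}\setminus\mathbb{Z}$) that is piecewise linear over $\mathcal{P}_B$ with rational breakpoints, i.e., $B\subseteq G=\frac1q\mathbb{Z}$ for some $q\in\mathbb{N}$. Then the moves closure $\mathrm{clsemi}_A(\Omega^0)$ of its initial move ensemble $\Omega^0$ has a finite presentation $(\Omega^{\mathrm{red}},\mathcal{C})$ in reduced form, where (i) the endpoints of all domains and the values $t$ and $r$ of moves $\tau_t|_D,\rho_r|_D\in\Omega^{\mathrm{red}}$ lie in $G\cap[0,1]$; (ii) the endpoints of all maximal intervals of all $C_i\in\mathcal{C}$ lie in $G\cap[0,1]$.
   Context: **Moves.** For $t,r\in\mathbb{R}$ let $\tau_t(x)=x+t$ (translation) and $\rho_r(x)=r-x$ (reflection). A move $\gamma|_D$ is the restriction of a translation or reflection $\gamma$ to a set $D\subseteq\mathbb{R}$ that is an open interval or empty, viewed as a partial bijection $D\to\gamma(D)$ (all empty translations are identified to one object, all empty reflections to another, distinct object). Composition: $\gamma_2|_{D_2}\circ\gamma_1|_{D_1}=(\gamma_2\circ\gamma_1)|_{D_1\cap\gamma_1^{-1}(D_2)}$; inverse: $(\gamma|_D)^{-1}=\gamma^{-1}|_{\gamma(D)}$. A move ensemble is a set of moves. For $O\subseteq\mathbb{R}^2$, $\mathrm{moves}_+(O)$ (resp. $\mathrm{moves}_-(O)$) is the set of translation (resp. reflection) moves whose graph $\{(x,\gamma(x)):x\in D\}$ is contained in $O$, and $\mathrm{moves}(O)=\mathrm{moves}_+(O)\cup\mathrm{moves}_-(O)$.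 **Closed move semigroups.** Let $A\subseteq\mathbb{R}$ be open. A closed move semigroup (with respect to $A$) is a move ensemble $\Gamma$ closed under composition and inverse such that: (restrict) if $\gamma|_D\in\Gamma$ and $D'\subseteq D$ is an open interval or empty then $\gamma|_{D'}\in\Gamma$; (continuation) if $\gamma|_I\in\Gamma$ for all $I$ in a family whose union $D$ is an interval, then $\gamma|_D\in\Gamma$; (extend$_A$) if $\gamma|_{D^i}\in\Gamma$ for all $i$ in an index set and $D$, empty or an open interval, satisfies $D\subseteq\mathrm{cl}(\bigcup_i D^i)\cap A\cap\gamma^{-1}(A)$, then $\gamma|_D\in\Gamma$; (lim) if $D$ is an open interval, $\gamma^i|_D\in\Gamma$ for all $i\in\mathbb{N}$ and $\gamma^i\to\gamma$ (all but finitely many $\gamma^i$ are of the same type as $\gamma$, and their parameters $t$ resp. $r$ converge to that of $\gamma$), then $\gamma|_D\in\Gamma$; (kaleido) for open intervals $D,I$: $\mathrm{moves}_+(D\times I)\subseteq\Gamma$ iff $\mathrm{moves}_-(D\times I)\subseteq\Gamma$. For an ensemble $\Omega'$ all of whose domains and images lie in $A$, the moves closure $\mathrm{clsemi}_A(\Omega')$ is the smallest closed move semigroup containing $\Omega'$. **Finite presentations.** $\mathrm{join}(\Omega')$ is the smallest ensemble containing $\Omega'$ satisfying (restrict) and (continuation). For a finite list $\mathcal{C}=\{C_1,\dots,C_k\}$ where each $C_i$ is a finite union of disjoint open intervals, $\mathrm{moves}(\mathcal{C})=\bigcup_i\mathrm{moves}(C_i\times C_i)$. A finite presentation of an ensemble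 $\Gamma$ satisfying (restrict), (continuation), (kaleido) is a pair $(\Omega,\mathcal{C})$ with $\Omega$ a finite ensemble and $\Gamma=\mathrm{join}(\Omega\cup\mathrm{moves}(\mathcal{C}))$. It is in reduced form if every move of $\Omega$ is maximal in $\Gamma$ with respect to restriction and is not in $\mathrm{join}(\mathrm{moves}(\mathcal{C}))$. **Minimal valid functions.** Fix $f\in\mathbb{R}\setminus\mathbb{Z}$. Write $\Delta\pi(x,y)=\pi(x)+\pi(y)-\pi(x+y)$. A function $\pi\colon\mathbb{R}\to\mathbb{R}$ is minimal valid iff $\pi\ge0$, $\pi$ is $\mathbb{Z}$-periodic, $\pi(0)=0$, $\pi(f)=1$, $\Delta\pi(x,y)\ge0$ and $\Delta\pi(x,f-x)=0$ for all $x,y\in\mathbb{R}$. **Piecewise linearity.** For $0=x_0<\dots<x_n=1$ let $B=\{x_0,\dots,x_{n-1}\}+\mathbb{Z}$, and let $\mathcal{P}_B$ be the complex consisting of the empty face, the singletons $\{x\}$, $x\in B$, and the closed intervals between consecutive points of $B$. A function is piecewise linear over $\mathcal{P}_B$ if on the relative interior of each face it agrees with an affine function (jumps at points of $B$ are allowed). **Initial moves.** $A$ is the maximal open subset of $(0,1)$ on which $\pi$ is continuous. $\Omega^0$ consists of the empty moves, of all the following moves with $D,\gamma(D)\subseteq A$, $D$ an open interval, and of their inverses: $\tau_t|_D$, $t\in(-1,1)$, with $\Delta\pi(x,t)=0$ for all $x\in D$; $\rho_r|_D$, $r\in(0,2)$, with $\Delta\pi(x,r-x)=0$ for all $x\in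 D$; $\tau_{\bar t}|_D$, $\bar t\in(-1,1)$, such that for all $x\in D$, $\lim_{t\to\bar t^+}\Delta\pi(x,t)=0$ or $\lim_{t\to\bar t^-}\Delta\pi(x,t)=0$; $\rho_{\bar r}|_D$, $\bar r\in(0,2)$, such that for all $x\in D$, $\lim_{r\to\bar r^+}\Delta\pi(x,r-x)=0$ or $\lim_{r\to\bar r^-}\Delta\pi(x,r-x)=0$.
   Formalization: In (i) the values t and r are shown to lie in G with t in (-1,1) and r in (0,2), not in G∩[0,1], which fails: for f=1/2 and π=1/2 off ½Z, π(0)=0, π(1/2)=1 (1-periodic), the reflection with r=3/2 on (1/2,1) must be in Ω^red. *)

(* Defs.v *)
From HB Require Import structures.
From mathcomp Require Import all_boot all_order all_algebra.
From mathcomp Require Import all_classical all_reals all_analysis.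
From mathcomp Require Import ring.

Set Implicit Arguments.
Unset Strict Implicit.
Unset Printing Implicit Defensive.

Import Order.TTheory GRing.Theory Num.Theory.
Import numFieldNormedType.Exports.

Local Open Scope classical_set_scope.
Local Open Scope ring_scope.

Section Moves.
Variable R : realType.
Implicit Types (D I J U : set R) (O : set (R * R)).

(* Unbounded intervals are allowed. *)
Definition open_interval D : Prop := [/\ open D, is_interval D & D !=set0].

Definition open_interval_or_empty D : Prop := open_interval D \/ D = set0.

Inductive umove : Type := Translation of R | Reflection of R.

Definition is_reflection (g : umove) : bool :=
  match g with Translation _ => false | Reflection _ => true end.

Definition param (g : umove) : R :=
  match g with Translation t => t | Reflection r => r end.

Definition uapply (g : umove) (x : R) : R :=
  match g with Translation t => x + t | Reflection r => r - x end.

Definition ucomp (g2 g1 : umove) : umove :=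
  match g2, g1 with
  | Translation s, Translation t => Translation (t + s)
  | Translation s, Reflection r => Reflection (r + s)
  | Reflection r, Translation t => Reflection (r - t)
  | Reflection r2, Reflection r1 => Translation (r2 - r1)
  end.

Lemma ucompE g2 g1 x : uapply (ucomp g2 g1) x = uapply g2 (uapply g1 x).
Proof. by case: g2 g1 => [s|r] [t|r'] /=; ring. Qed.

Definition uinv (g : umove) : umove :=
  match g with Translation t => Translation (- t) | Reflection r => Reflection r end.

Lemma uinvK g x : uapply (uinv g) (uapply g x) = x.
Proof. by case: g => [t|r] /=; rewrite ?addrK ?subKr. Qed.

(* A partial map together with a translation/reflection tag: all the empty
   restrictions of translations are equal, all the empty restrictions of
   reflections are equal, and the tag keeps these two apart. *)
Record tagged_map : Type := TaggedMap { tag_refl : bool ; graph : set (R * R) }.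

Definition restr (g : umove) D : tagged_map :=
  TaggedMap (is_reflection g) [set p | D p.1 /\ p.2 = uapply g p.1].

Definition is_move : set tagged_map :=
  [set m | exists g D, open_interval_or_empty D /\ m = restr g D].

Definition is_restriction (m m' : tagged_map) : Prop :=
  tag_refl m = tag_refl m' /\ graph m `<=` graph m'.

Definition moves_tag (b : bool) O : set tagged_map :=
  [set m | [/\ is_move m, tag_refl m = b & graph m `<=` O]].

Definition moves_plus O := moves_tag false O.
Definition moves_minus O := moves_tag true O.
Definition moves O := moves_plus O `|` moves_minus O.

Implicit Types (Gam W : set tagged_map).

Definition ensemble W : Prop := W `<=` is_move.

Definition closed_comp Gam : Prop := forall g1 g2 D1 D2,
  Gam (restr g1 D1) -> Gam (restr g2 D2) ->
  Gam (restr (ucomp g2 g1) (D1 `&` uapply g1 @^-1` D2)).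

Definition closed_inv Gam : Prop := forall g D,
  Gam (restr g D) -> Gam (restr (uinv g) (uapply g @` D)).

Definition ax_restrict Gam : Prop := forall g D D',
  Gam (restr g D) -> D' `<=` D -> open_interval_or_empty D' ->
  Gam (restr g D').

Definition ax_continuation Gam : Prop := forall g (F : set (set R)),
  (forall I, F I -> Gam (restr g I)) ->
  open_interval (\bigcup_(I in F) I) -> Gam (restr g (\bigcup_(I in F) I)).

Definition ax_extend (A : set R) Gam : Prop := forall g (F : set (set R)) D,
  (forall I, F I -> Gam (restr g I)) ->
  open_interval_or_empty D ->
  D `<=` closure (\bigcup_(I in F) I) `&` A `&` uapply g @^-1` A ->
  Gam (restr g D).

Definition umove_cvg (gs : nat -> umove) (g : umove) : Prop :=
  (\forall i \near \oo, is_reflection (gs i) = is_reflection g) /\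
  (fun i => param (gs i)) @ \oo --> param g.

Definition ax_lim Gam : Prop := forall (gs : nat -> umove) g D,
  open_interval D -> (forall i, Gam (restr (gs i) D)) -> umove_cvg gs g ->
  Gam (restr g D).

Definition ax_kaleido Gam : Prop := forall D I,
  open_interval D -> open_interval I ->
  (moves_plus (D `*` I) `<=` Gam <-> moves_minus (D `*` I) `<=` Gam).

Definition closed_move_semigroup (A : set R) Gam : Prop :=
  [/\ ensemble Gam, closed_comp Gam & closed_inv Gam] /\
  [/\ ax_restrict Gam, ax_continuation Gam, ax_extend A Gam, ax_lim Gam
    & ax_kaleido Gam].

Definition clsemi (A : set R) W : set tagged_map :=
  smallest (closed_move_semigroup A) W.

Definition join W : set tagged_map :=
  smallest [set Gam | [/\ ensemble Gam, ax_restrict Gam & ax_continuation Gam]] W.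

Definition finite_union_disjoint_intervals U : Prop :=
  exists F : set (set R), [/\ finite_set F, F `<=` open_interval, trivIset F id
    & U = \bigcup_(I in F) I].

Definition moves_list (C : set (set R)) : set tagged_map :=
  \bigcup_(U in C) moves (U `*` U).

Definition finite_presentation Gam W (C : set (set R)) : Prop :=
  [/\ ax_restrict Gam, ax_continuation Gam & ax_kaleido Gam] /\
  [/\ ensemble W, finite_set W, finite_set C,
      C `<=` finite_union_disjoint_intervals
    & Gam = join (W `|` moves_list C)].

Definition maximal_move Gam (m : tagged_map) : Prop :=
  Gam m /\ forall m', Gam m' -> is_restriction m m' -> m' = m.

Definition reduced_form Gam W (C : set (set R)) : Prop :=
  forall m, W m -> maximal_move Gam m /\ ~ join (moves_list C) m.

Definition maximal_interval U J : Prop :=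
  [/\ is_interval J, J !=set0, J `<=` U
    & forall J', is_interval J' -> J `<=` J' -> J' `<=` U -> J' = J].

(* In particular, the open interval D is bounded. *)
Definition endpoints_in (P : set R) D : Prop :=
  exists a b, [/\ a < b, D = `]a, b[%classic, P a & P b].

End Moves.

Section MinimalFunctions.
Variable R : realType.
Implicit Types (f : R) (pi : R -> R).

Definition delta pi (x y : R) : R := pi x + pi y - pi (x + y).

Definition minimal_valid f pi : Prop :=
  [/\ forall x, 0 <= pi x,
      forall x (z : int), pi (x + z%:~R) = pi x,
      pi 0 = 0 & pi f = 1] /\
  ((forall x y, 0 <= delta pi x y) /\ (forall x, delta pi x (f - x) = 0)).

Definition subdivision (n : nat) (x : nat -> R) : Prop :=
  [/\ x 0%N = 0, x n = 1 & forall i, (i < n)%N -> x i < x i.+1].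

Definition breakpoints (n : nat) (x : nat -> R) : set R :=
  [set b | exists i (z : int), (i < n)%N /\ b = x i + z%:~R].

Definition consecutive (B : set R) (a b : R) : Prop :=
  [/\ B a, B b, a < b & forall c, B c -> ~ (a < c < b)].

(* The relative interiors of the faces of the complex P_B. *)
Definition relint_faces (B : set R) : set (set R) :=
  [set F | [\/ F = set0, (exists2 b, B b & F = [set b])
             | exists a b, consecutive B a b /\ F = `]a, b[%classic]].

Definition piecewise_linear (B : set R) pi : Prop :=
  forall F, relint_faces B F ->
  exists s c : R, forall x, F x -> pi x = s * x + c.

Definition grid (q : nat) : set R := [set y | exists z : int, y = z%:~R / q%:R].

(* The largest open subset of (0,1) on which pi is continuous. *)
Definition continuity_domain pi : set R :=
  \bigcup_(U in [set U : set R |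
    [/\ open U, U `<=` `]0, 1[%classic & {within U, continuous pi}]]) U.

Definition initial_condition pi (g : umove R) (D : set R) : Prop :=
  match g with
  | Translation t => -1 < t < 1 /\
      ((forall x, D x -> delta pi x t = 0) \/
       (forall x, D x ->
          delta pi x s @[s --> t^'+] --> (0 : R) \/
          delta pi x s @[s --> t^'-] --> (0 : R)))
  | Reflection r => 0 < r < 2 /\
      ((forall x, D x -> delta pi x (r - x) = 0) \/
       (forall x, D x ->
          delta pi x (s - x) @[s --> r^'+] --> (0 : R) \/
          delta pi x (s - x) @[s --> r^'-] --> (0 : R)))
  end.

Definition initial_move pi (g : umove R) (D : set R) : Prop :=
  [/\ open_interval D, D `<=` continuity_domain pi,
      uapply g @` D `<=` continuity_domain pi & initial_condition pi g D].

Definition initial_ensemble pi : set (tagged_map R) :=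
  [set m | [\/ exists g, m = restr g set0,
              (exists g D, initial_move pi g D /\ m = restr g D)
            | exists g D, initial_move pi g D /\
                m = restr (uinv g) (uapply g @` D)]].

(* The parameter range allowed for the initial moves: (-1,1) for translations
   and (0,2) for reflections. *)
Definition param_range (g : umove R) : set R :=
  match g with Translation _ => `]-1, 1[%classic | Reflection _ => `]0, 2[%classic end.

End MinimalFunctions.

(* Main.v *)
Require Import Defs.
From mathcomp Require Import all_boot all_order all_algebra.
From mathcomp Require Import all_classical all_reals all_analysis.
From mathcomp Require Import ring lra.

(** Cut the line into the open cells (a/q, (a+1)/q). On a product of cells the
    subadditivity slack of pi is affine and nonnegative, so it vanishes
    identically as soon as it vanishes at one interior point. Hence an initial
    move whose parameter lies on the grid extends to whole cells, while one
    whose parameter is off the grid comes with a two-dimensional triangle of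
    zeros, and (kaleido) then puts every move between the two cells involved
    into the closure. The moves within A that, at every non-grid point, either
    connect two such linked cells or are grid moves that the closure contains
    on the whole cell form a closed move semigroup (limits are harmless because
    the grid is discrete); it contains the initial moves, so it is the closure.
    The components of linked cells give C. A maximal move not generated by C has
    a grid parameter, and its domain is a union of cells and grid points, so
    there are finitely many of them. *)

Set Implicit Arguments.
Unset Strict Implicit.
Unset Printing Implicit Defensive.

Import Order.TTheory GRing.Theory Num.Theory.
Import numFieldNormedType.Exports.

Local Open Scope classical_set_scope.
Local Open Scope ring_scope.

(** * Open intervals, moves and closed move semigroups *)

Section Intervals.
Variable R : realType.
Implicit Types (D E : set R) (g : umove R).

Lemma uinvKV g (x : R) : uapply g (uapply (uinv g) x) = x.
Proof. by case: g => [t|r] /=; ring. Qed.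

Lemma uapply_continuous g : continuous (uapply g).
Proof.
move=> x; case: g => [t|r] /=.
  by apply: cvgD; [exact: cvg_id|exact: cvg_cst].
by apply: cvgB; [exact: cvg_cst|exact: cvg_id].
Qed.

Lemma image_uapply g D : uapply g @` D = uapply (uinv g) @^-1` D.
Proof.
apply/seteqP; split => [_ [x Dx <-]|y Dy] /=; first by rewrite uinvK.
by exists (uapply (uinv g) y) => //; rewrite uinvKV.
Qed.

Lemma is_intervalI D E :
  is_interval D -> is_interval E -> is_interval (D `&` E).
Proof.
move=> iD iE x y [Dx Ex] [Dy Ey] z xzy.
by split; [exact: (iD x y)|exact: (iE x y)].
Qed.

Lemma is_intervalU D E : is_interval D -> is_interval E ->
  D `&` E !=set0 -> is_interval (D `|` E).
Proof.
move=> iD iE [c [Dc Ec]] x y xU yU z /andP[xz zy].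
have [zc|cz] := leP z c.
  by case: xU => ?; [left; apply: (iD x c)|right; apply: (iE x c)] => //;
    rewrite xz zc.
by case: yU => ?; [left; apply: (iD c y)|right; apply: (iE c y)] => //;
  rewrite zy ltW.
Qed.

Lemma is_interval_preimage g D :
  is_interval D -> is_interval (uapply g @^-1` D).
Proof.
move=> iD x y Dx Dy z /andP[xz zy]; case: g Dx Dy => [t|r] /= Dx Dy.
  by apply: (iD _ _ Dx Dy); rewrite !lerD2r xz zy.
by apply: (iD _ _ Dy Dx); rewrite !lerD2l !lerN2 xz zy.
Qed.

Lemma open_intervalI D E : open_interval D -> open_interval E ->
  D `&` E !=set0 -> open_interval (D `&` E).
Proof.
by move=> [oD iD _] [oE iE _] DE; split => //; [exact: openI|exact: is_intervalI].
Qed.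

Lemma open_intervalU D E : open_interval D -> open_interval E ->
  D `&` E !=set0 -> open_interval (D `|` E).
Proof.
move=> [oD iD [d Dd]] [oE iE _] DE.
by split; [exact: openU|exact: is_intervalU|exists d; left].
Qed.

Lemma open_interval_preimage g D :
  open_interval D -> open_interval (uapply g @^-1` D).
Proof.
move=> [oD iD [y Dy]]; split; last by exists (uapply (uinv g) y); rewrite /= uinvKV.
  by apply: open_comp => // x _; exact: uapply_continuous.
exact: is_interval_preimage.
Qed.

Lemma open_interval_image g D :
  open_interval D -> open_interval (uapply g @` D).
Proof. by rewrite image_uapply; exact: open_interval_preimage. Qed.

Lemma open_interval_itv (a b : R) : a < b -> open_interval `]a, b[%classic.
Proof.
move=> ab; split; [exact: interval_open|exact: interval_is_interval|].
by exists ((a + b) / 2); rewrite /= in_itv /= midf_lt// midf_lt.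
Qed.

Lemma open_interval_bounded D (a b : R) : open_interval D ->
  D `<=` `]a, b[%classic ->
  exists c d, [/\ a <= c, c < d, d <= b & D = `]c, d[%classic].
Proof.
move=> [oD iD D0] Dab.
have lbD : lbound D a by move=> y /Dab; rewrite /= in_itv /= => /andP[/ltW].
have ubD : ubound D b by move=> y /Dab; rewrite /= in_itv /= => /andP[_ /ltW].
have DE : D = `]inf D, sup D[%classic.
  by rewrite -interval_bounded_interior//;
    [rewrite (iffLR (interior_id D))|exists a|exists b].
exists (inf D), (sup D); split => //.
- exact: lb_le_inf.
- by case: D0 => y; rewrite {1}DE /= in_itv /= => /andP[]; exact: lt_trans.
- exact: ge_sup.
Qed.

Lemma open_intervalS D E (x : R) : open_interval D ->
  open_interval E -> D x -> E x ->
  open_interval_or_empty (D `&` E).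
Proof. by move=> *; left; apply: open_intervalI => //; exists x. Qed.

End Intervals.

(** * Moves as tagged graphs, and the axioms for the closure *)

Section RestrictedMoves.
Variable R : realType.
Implicit Types (D E : set R) (g : umove R).

(** The unique move of type [b] taking [x] to [y]: each point of a rectangle determines one
    translation and one reflection. *)
Definition mvto (b : bool) (x y : R) : umove R :=
  if b then Reflection (x + y) else Translation (y - x).

Lemma mvtoE b x y : uapply (mvto b x y) x = y.
Proof. by case: b => /=; ring. Qed.

Lemma is_reflection_mvto b x y : is_reflection (mvto b x y) = b.
Proof. by case: b. Qed.

Lemma mvto_uapply g x : mvto (is_reflection g) x (uapply g x) = g.
Proof. by case: g => t /=; rewrite /mvto; congr (_ _); ring. Qed.

Lemma ucompVK (g h : umove R) : ucomp (ucomp g (uinv h)) h = g.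
Proof. by case: g h => ? [?|?] /=; congr (_ _); ring. Qed.

Lemma uinv_inv : involutive (@uinv R).
Proof. by case=> [t|r] //=; rewrite opprK. Qed.

Lemma restr_set0 g h : is_reflection g = is_reflection h ->
  restr g set0 = restr h set0.
Proof.
by move=> gh; rewrite /restr gh; congr TaggedMap; apply/seteqP; split => p [].
Qed.

(** Once its type is known, a move is determined by a single point of its graph, so a nonempty
    domain determines [g]. *)
Lemma is_restriction_restr g h D E : D !=set0 ->
  is_restriction (restr g D) (restr h E) -> g = h /\ D `<=` E.
Proof.
move=> [x Dx] [/= gh sDE].
have [Ex hx] : E x /\ uapply g x = uapply h x by exact: (sDE (x, uapply g x)).
split; first by rewrite -(mvto_uapply g x) hx gh mvto_uapply.
by move=> y Dy; have [] : E y /\ uapply g y = uapply h y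
  by exact: (sDE (y, uapply g y)).
Qed.

Lemma restr_inj g h D E : D !=set0 -> restr g D = restr h E -> g = h /\ D = E.
Proof.
move=> D0 e.
have [gh DE] : g = h /\ D `<=` E.
  by apply: is_restriction_restr => //; rewrite e; split.
split=> //; apply/seteqP; split=> //.
have [] // : h = g /\ E `<=` D.
by apply: is_restriction_restr; [case: D0 => x /DE Ex; exists x|rewrite e; split].
Qed.

Lemma graph_restrS g D O :
  graph (restr g D) `<=` O <-> forall x, D x -> O (x, uapply g x).
Proof. by split=> [h x Dx|h [x y] [/= Dx ->]]; [apply: h|apply: h]. Qed.

Lemma is_restriction_sub g D E : D `<=` E ->
  is_restriction (restr g D) (restr g E).
Proof. by move=> DE; split=> // -[x y] [/= /DE Ex ->]. Qed.

Lemma moves_tag_restr b g D O : open_interval_or_empty D ->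
  is_reflection g = b -> (forall x, D x -> O (x, uapply g x)) ->
  moves_tag b O (restr g D).
Proof. by move=> oD gb h; split=> //; [exists g, D|exact/graph_restrS]. Qed.

Lemma is_move_closed_semigroup (A : set R) :
  closed_move_semigroup A (@is_move R).
Proof.
have inv g D : is_move (restr g D) -> open_interval_or_empty D.
  move=> [h [E [oE e]]]; have [->|D0] := eqVneq D set0; first by right.
  by have [_ ->] := restr_inj (iffLR (set0P _) D0) e.
split; split.
- by [].
- move=> g1 g2 D1 D2 /inv o1 /inv o2; do 2!eexists; split; last by [].
  have [->|/set0P D0] := eqVneq (D1 `&` uapply g1 @^-1` D2) set0; first by right.
  left; case: o1 D0 => [ d1| ->]; last by rewrite set0I => -[].
  case: o2 => [ d2| ->]; last by rewrite preimage_set0 setI0 => -[].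
  by move=> D0; apply: open_intervalI => //; exact: open_interval_preimage.
- move=> g D /inv oD; do 2!eexists; split; last by [].
  case: oD => [?| ->]; first by left; exact: open_interval_image.
  by right; rewrite image_set0.
- by move=> g D D' _ _ oD'; exists g, D'.
- by move=> g F _ oF; exists g, (\bigcup_(I in F) I); split=> //; left.
- by move=> g F D _ oD _; exists g, D.
- by move=> gs g D oD _ _; exists g, D; split => //; left.
- by move=> D I _ _; split=> _ m [].
Qed.

(** The axioms are closure conditions and pass to intersections. That the intersection consists of
    moves follows because the set of all moves is one of the semigroups intersected. *)
Lemma clsemi_closed (A : set R) (W : set (tagged_map R)) :
  ensemble W -> closed_move_semigroup A (clsemi A W).
Proof.
move=> eW; split; split.
- by move=> m; apply; split; [exact: is_move_closed_semigroup|exact: eW].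
- move=> g1 g2 D1 D2 h1 h2 G GP; have [[_ c _] _] := GP.1.
  by apply: c; [exact: h1|exact: h2].
- by move=> g D h G GP; have [[_ _ c] _] := GP.1; apply: c; exact: h.
- move=> g D D' h ? ? G GP; have [_ [c _ _ _ _]] := GP.1.
  by apply: (c g D) => //; exact: h.
- move=> g F h oF G GP; have [_ [_ c _ _ _]] := GP.1.
  by apply: c => // I FI; exact: h.
- move=> g F D h oD sD G GP; have [_ [_ _ c _ _]] := GP.1.
  by apply: (c g F D) => // I FI; exact: h.
- move=> gs g D oD h cv G GP; have [_ [_ _ _ c _]] := GP.1.
  by apply: (c gs g D) => // i; exact: h.
- move=> D I oD oI; split=> h m mD G GP; have [_ [_ _ _ _ c]] := GP.1;
    by apply: (iffLR (c D I oD oI)) mD || apply: (iffRL (c D I oD oI)) mD;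
    move=> m' /h; apply.
Qed.

End RestrictedMoves.

(** * Germs of moves at a point *)

Section Germs.
Variables (R : realType) (A : set R) (Gam : set (tagged_map R)).
Hypothesis GamP : closed_move_semigroup A Gam.
Implicit Types (D E : set R) (g : umove R).

Definition germ g (x : R) : Prop :=
  exists D, [/\ open_interval D, D x & Gam (restr g D)].

(** Membership is local: (restrict) cuts the germs down to subintervals of [D], and (continuation)
    glues these. *)
Lemma Gam_germP g D :
  open_interval D -> Gam (restr g D) <-> forall x, D x -> germ g x.
Proof.
have [_ [res con _ _ _]] := GamP; move=> oD; split=> [GD x Dx|gD].
  by exists D.
pose F := [set I : set R | Gam (restr g I) /\ I `<=` D].
have DE : D = \bigcup_(I in F) I.
  apply/seteqP; split => [x Dx|x [I [_ ID] /ID]//].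
  have [E [oE Ex GE]] := gD x Dx; exists (D `&` E) => //; split; last by move=> ? [].
  by apply: res GE _ _; [move=> ? []|apply: open_intervalS oD oE Dx Ex].
by rewrite DE; apply: con => [I []//|]; rewrite -DE.
Qed.

Lemma germ_comp g2 g1 x :
  germ g1 x -> germ g2 (uapply g1 x) -> germ (ucomp g2 g1) x.
Proof.
have [[_ cmp _] _] := GamP.
move=> [D1 [d1 D1x G1]] [D2 [d2 D2x G2]].
exists (D1 `&` uapply g1 @^-1` D2); split=> //; last exact: cmp.
apply: open_intervalI => //; first exact: open_interval_preimage.
by exists x.
Qed.

Lemma germ_inv g x : germ g x -> germ (uinv g) (uapply g x).
Proof.
have [[_ _ inv] _] := GamP; move=> [D [oD Dx GD]].
by exists (uapply g @` D); split=> //;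
  [exact: open_interval_image|exact: inv].
Qed.

(** Exactly two moves take [x] to [y], one of each type; both are required to have a germ at [x]. *)
Definition linked x y := forall g, uapply g x = y -> germ g x.

Lemma linked_sym x y : linked x y -> linked y x.
Proof.
move=> xy g gy; have e : uapply (uinv g) x = y by rewrite -gy uinvK.
by have := germ_inv (xy _ e); rewrite uinv_inv e.
Qed.

(** Factor [g] through the translation from [x] to [y]; the remaining factor takes [y] to [z] and
    has the type of [g]. *)
Lemma linked_trans y x z : linked x y -> linked y z -> linked x z.
Proof.
move=> xy yz g gx; pose h := mvto false x y.
have hx : uapply h x = y by exact: mvtoE.
rewrite -(ucompVK g h); apply: germ_comp; first exact: xy.
by rewrite hx; apply: yz; rewrite ucompE -hx uinvK.
Qed.

(** Pointwise form of (kaleido): germs of a single type over a rectangle yield germs of both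
    types. *)
Lemma linked_kaleido b D E : open_interval D -> open_interval E ->
  (forall x y, D x -> E y -> germ (mvto b x y) x) ->
  forall x y, D x -> E y -> linked x y.
Proof.
have [[ens _ _] [res _ _ _ kal]] := GamP; move=> oD oE h.
have hb : moves_tag b (D `*` E) `<=` Gam.
  move=> m [[g [I [oI ->]]] /= gb /graph_restrS sI].
  case: oI => [oI| ->].
    apply/Gam_germP => // x /sI [/= Dx Ex].
    by rewrite -(mvto_uapply g x) gb; exact: h.
  (* The empty move of type [b] also has its graph in the rectangle; it is a restriction of any move
     giving one of the germs. *)
  have [x Dx] : D !=set0 by case: oD.
  have [y Ey] : E !=set0 by case: oE.
  rewrite (@restr_set0 _ _ (mvto b x y)); last by rewrite is_reflection_mvto.
  have [J [_ _ GI]] := h x y Dx Ey.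
  by apply: res GI _ _ => //; right.
have hall c : moves_tag c (D `*` E) `<=` Gam.
  have [pm mp] := kal D E oD oE.
  by case: b hb {h} => hb; case: c => //; [exact: mp|exact: pm].
move=> x y Dx Ey g gx.
exists (D `&` uapply g @^-1` E); split=> //.
- apply: open_intervalI => //; first exact: open_interval_preimage.
  by exists x; rewrite /= gx.
- by rewrite /= gx.
apply: (hall (is_reflection g)); apply: moves_tag_restr => //.
left; apply: open_intervalI => //; first exact: open_interval_preimage.
by exists x; rewrite /= gx.
Qed.

End Germs.

(** * Cells of the grid *)

Section Cells.
Variables (R : realType) (q : nat).
Hypothesis q_gt0 : (0 < q)%N.
Implicit Types (D E : set R) (g : umove R) (a b c : int).

Let Q_gt0 : 0 < q%:R :> R. Proof. by rewrite ltr0n. Qed.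

Lemma gridP (x : R) : grid q x <-> exists z : int, x * q%:R = z%:~R.
Proof.
split=> -[z zx]; exists z; first by rewrite zx divfK// gt_eqF.
by rewrite -zx mulfK// gt_eqF.
Qed.

Definition grid_cell a : set R := [set y | a%:~R < y * q%:R < a%:~R + 1].

(** For a grid point this is the index of the cell to its right. *)
Definition grid_idx (x : R) : int := Num.floor (x * q%:R).

Lemma cell_itv a : grid_cell a = `]a%:~R / q%:R, (a%:~R + 1) / q%:R[%classic.
Proof.
apply/seteqP; split=> y; rewrite /= in_itv /= ltr_pdivrMr// ltr_pdivlMr//.
Qed.

Lemma open_interval_cell a : open_interval (grid_cell a).
Proof.
by rewrite cell_itv; apply: open_interval_itv; rewrite ltr_pM2r ?invr_gt0// ltrDl.
Qed.

Lemma cell_ex a : exists x, grid_cell a x.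
Proof. by have [_ _ [x]] := open_interval_cell a; exists x. Qed.

Lemma cell_idx a x : grid_cell a x -> grid_idx x = a.
Proof. by move=> /andP[? ?]; apply: floor_def; rewrite ltW//= intrD. Qed.

Lemma cell_ngrid a x : grid_cell a x -> ~ grid q x.
Proof.
move=> /andP[ax xa] /gridP[z zx]; move: ax xa; rewrite zx -intrD1 !ltr_int.
by rewrite ltzD1 => /lt_geF ->.
Qed.

Lemma ngrid_cell x : ~ grid q x -> grid_cell (grid_idx x) x.
Proof.
move=> ngx; rewrite /grid_cell /= -intrD1 floorD1_gt andbT lt_neqAle floor_le andbT.
by apply/eqP => e; apply: ngx; apply/gridP; exists (grid_idx x).
Qed.

Lemma cell_near a x : grid_cell a x -> \forall y \near x, grid_cell a y.
Proof.
by move=> ax; apply: open_nbhs_nbhs; split=> //; case: (open_interval_cell a).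
Qed.

(** A move with grid parameter permutes the cells. *)
Lemma cell_uapply g a : grid q (param g) ->
  exists b, forall y, grid_cell a y <-> grid_cell b (uapply g y).
Proof.
case: g => [t|r] /gridP[z /= zE].
  by exists (a + z) => y; rewrite /grid_cell /= mulrDl zE intrD; split=> /andP[? ?]; lra.
(* A reflection swaps the ends of the cell, so the new left end comes from [a + 1]. *)
exists (z - a - 1) => y; rewrite /grid_cell /= mulrBl zE !intrB /=.
by split=> /andP[? ?]; lra.
Qed.

Lemma cell_uapply_idx g x y : grid q (param g) -> ~ grid q x ->
  grid_cell (grid_idx x) y <-> grid_cell (grid_idx (uapply g x)) (uapply g y).
Proof.
move=> gg /ngrid_cell xx; have [b bP] := cell_uapply (grid_idx x) gg.
have /cell_idx -> := iffLR (bP x) xx; exact: bP.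
Qed.

Lemma grid_uinv g : grid q (param g) -> grid q (param (uinv g)).
Proof. by case: g => //= t [z ->]; exists (- z); rewrite mulrNz mulNr. Qed.

Lemma grid_ucomp g2 g1 :
  grid q (param g2) -> grid q (param g1) -> grid q (param (ucomp g2 g1)).
Proof.
by case: g2 g1 => [t|r] [t'|r'] /= [z ->] [z' ->];
  [exists (z' + z)|exists (z' + z)|exists (z - z')|exists (z - z')];
  rewrite ?intrB ?intrD mulrDl ?mulNr.
Qed.

Lemma grid_uapply g x : grid q (param g) -> grid q (uapply g x) -> grid q x.
Proof.
move=> gg ggx; apply: contrapT => /ngrid_cell xx.
by have [b /(_ x)/iffLR/(_ xx)/cell_ngrid] := cell_uapply (grid_idx x) gg.
Qed.

Lemma ngrid_dnbhs (x : R) : \forall y \near x^', ~ @grid R q y.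
Proof.
(* [lo] and [hi] lie strictly on either side of [x], on the grid or not. A grid point between them,
   scaled by [q], is at least the ceiling and at most the floor of [x * q], hence equals it. *)
set lo := ((Num.ceil (x * q%:R) - 1)%:~R / q%:R : R).
set hi := ((Num.floor (x * q%:R) + 1)%:~R / q%:R : R).
have xlh : x \in `]lo, hi[.
  by rewrite in_itv /= ltr_pdivrMr// ltr_pdivlMr// gt_pred_ceil floorD1_gt.
have := near_in_itvoo xlh; rewrite /dnbhs /within /=.
apply: filterS => y; rewrite in_itv /= ltr_pdivrMr// ltr_pdivlMr// => /andP[ly yh].
move=> yx /gridP[z zy]; move: ly yh; rewrite zy !ltr_int ltzD1.
rewrite ltrBlDr ltzD1 => cz zf; move/eqP: yx; apply.
apply: (@mulIf _ q%:R); first by rewrite gt_eqF.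
rewrite zy; apply/eqP; rewrite eq_le.
rewrite (le_trans _ (floor_le (x * q%:R))) ?ler_int//=.
by rewrite (le_trans (ceil_ge (x * q%:R))) ?ler_int.
Qed.

Lemma ngrid_uapply_dnbhs g x : \forall y \near x^', ~ @grid R q (uapply g y).
Proof.
have h : uapply g y @[y --> x^'] --> (uapply g x)^'.
  apply: continuous_injective_withinNx; first exact: uapply_continuous.
  by move=> y /(congr1 (uapply (uinv g))); rewrite !uinvK.
exact: h (ngrid_dnbhs _).
Qed.

Lemma uapply_near g x (P : set R) :
  (\forall y \near uapply g x, P y) -> \forall y \near x, P (uapply g y).
Proof. exact: uapply_continuous. Qed.

End Cells.

(** * The semigroup of grid moves and linked cells *)

Section MoveLimits.
Variable R : realType.

Lemma umove_cvg_at (gs : nat -> umove R) (g : umove R) (x : R) :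
  umove_cvg gs g -> uapply (gs i) x @[i --> \oo] --> uapply g x.
Proof.
move=> [tag_cvg par_cvg].
(* Give every [gs i] the type of [g]; this changes only finitely many of them. *)
have h : uapply (if is_reflection g then Reflection (param (gs i))
    else Translation (param (gs i))) x @[i --> \oo] --> uapply g x.
  case: g par_cvg {tag_cvg} => t /= ct.
    by apply: cvgD => //; exact: cvg_cst.
  by apply: cvgB => //; exact: cvg_cst.
apply: cvg_trans h; apply: near_eq_cvg; apply: filterS tag_cvg => i.
by case: (gs i) => t /= <-.
Qed.

Lemma umove_cvg_uinv (gs : nat -> umove R) (g : umove R) :
  umove_cvg gs g -> umove_cvg (fun i => uinv (gs i)) (uinv g).
Proof.
move=> [tag_cvg par_cvg]; split.
  by apply: filterS tag_cvg => i; case: (gs i) (g) => [?|?] [?|?].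
case: g tag_cvg par_cvg => t /= tag_cvg par_cvg.
  apply: cvg_trans (cvgN par_cvg); apply: near_eq_cvg.
  by apply: filterS tag_cvg => i; rewrite fctE; case: (gs i).
apply: cvg_trans par_cvg; apply: near_eq_cvg.
by apply: filterS tag_cvg => i; case: (gs i).
Qed.

End MoveLimits.

(** * Good moves form a closed move semigroup *)

Section GridSemigroup.
Variables (R : realType) (q : nat).
Hypothesis q_gt0 : (0 < q)%N.
Variables (A : set R) (Gam : set (tagged_map R)).
Hypothesis GamP : closed_move_semigroup A Gam.
Implicit Types (D E : set R) (g : umove R) (a b c : int).

Local Notation cell := (@grid_cell R q).
Local Notation idx := (@grid_idx R q).
Local Notation germ := (@germ R Gam).
Local Notation linked := (linked Gam).

Definition cells_linked a b := forall x y, cell a x -> cell b y -> linked x y.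

Lemma cells_linked_sym a b : cells_linked a b -> cells_linked b a.
Proof. by move=> ab x y bx ay; apply: linked_sym GamP _ _ _; exact: ab. Qed.

Lemma cells_linked_trans b a c :
  cells_linked a b -> cells_linked b c -> cells_linked a c.
Proof.
move=> ab bc x y ax cy; have [z bz] := cell_ex R q_gt0 b.
by apply: (linked_trans GamP (y := z)); [exact: ab|exact: bc].
Qed.

(** For fixed [g] this depends only on the cells of [x] and of its image; germs are asked on the
    whole cell for that reason. *)
Definition good g x := cells_linked (idx x) (idx (uapply g x)) \/
  grid q (param g) /\ forall y, cell (idx x) y -> germ g y.

Lemma good_germ g x : ~ grid q x -> ~ grid q (uapply g x) -> good g x -> germ g x.
Proof.
move=> /(ngrid_cell q_gt0) cx /(ngrid_cell q_gt0) cgx [l|[_]]; last exact.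
exact: l cx cgx _ _.
Qed.

Lemma good_idx g x y : idx x = idx y -> idx (uapply g x) = idx (uapply g y) ->
  good g x -> good g y.
Proof. by rewrite /good => -> ->. Qed.

Lemma good_inv g x : ~ grid q x -> good g x -> good (uinv g) (uapply g x).
Proof.
move=> ngx [l|[gg gx]]; rewrite /good uinvK; first by left; exact: cells_linked_sym.
right; split=> [|y cy]; first exact: grid_uinv.
rewrite -(uinvKV g y); apply: (germ_inv GamP); apply: gx.
by rewrite (cell_uapply_idx q_gt0 _ gg)// uinvKV.
Qed.

Lemma linked_germ g x y : linked x y -> germ g y -> linked x (uapply g y).
Proof.
move=> xy gy h hx; have e : uapply (ucomp (uinv g) h) x = y.
  by rewrite ucompE hx uinvK.
have -> : h = ucomp g (ucomp (uinv g) h).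
  by case: (h) (g) => ? [?|?] /=; congr (_ _); ring.
by apply: (germ_comp GamP); [exact: xy|rewrite e].
Qed.

(** Linked cells compose by transitivity. A grid move with germs on a whole cell carries that cell
    onto a cell, so it transports links, and two such moves compose to a third. *)
Lemma good_comp g2 g1 x : ~ grid q x -> ~ grid q (uapply g1 x) ->
  good g1 x -> good g2 (uapply g1 x) -> good (ucomp g2 g1) x.
Proof.
move=> ngx ng1; rewrite /good ucompE; move=> [l1|[gg1 h1]] [l2|[gg2 h2]].
- by left; exact: cells_linked_trans l1 l2.
- left=> y z cy cz; rewrite -(uinvKV g2 z).
  have c1 : cell (idx (uapply g1 x)) (uapply (uinv g2) z).
    by rewrite (cell_uapply_idx q_gt0 _ gg2)// uinvKV.
  by apply: linked_germ; [exact: l1|exact: h2].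
- left=> y z cy cz; apply: (linked_sym GamP); rewrite -(uinvK g1 y).
  have c1 : cell (idx (uapply g1 x)) (uapply g1 y) by rewrite -cell_uapply_idx.
  apply: linked_germ; first by apply: (linked_sym GamP); exact: l2.
  by apply: (germ_inv GamP); exact: h1.
- right; split=> [|y cy]; first exact: grid_ucomp.
  by apply: (germ_comp GamP); [exact: h1|apply: h2; rewrite -cell_uapply_idx].
Qed.

(** Goodness is asked only where both ends are off the grid; at the remaining points membership in
    [A] suffices, because (extend) fills them in. *)
Definition good_on g D := forall x, D x -> [/\ A x, A (uapply g x) &
  ~ grid q x -> ~ grid q (uapply g x) -> good g x].

Definition good_moves : set (tagged_map R) := [set m |
  exists g D, [/\ m = restr g D, open_interval_or_empty D & good_on g D]].

Lemma good_movesP g D : good_moves (restr g D) <->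
  open_interval_or_empty D /\ good_on g D.
Proof.
split=> [[h [E [e oE hE]]]|[oD gD]]; last by exists g, D.
have [D0|/set0P D0] := eqVneq D set0.
  by rewrite D0; split=> [|x//]; right.
by have [-> ->] := restr_inj D0 e.
Qed.

(** Germs exist near every point of [D], outside a discrete set. So [D] lies in the closure of the
    intervals on which [g] is in [Gam], and since [D] and its image lie in [A], (extend) applies. *)
Lemma good_moves_sub : good_moves `<=` Gam.
Proof.
have [_ [_ _ ext _ _]] := GamP.
move=> _ [g [D [-> oD gD]]]; case: oD gD => [oD| ->] gD; last first.
  by apply: (ext g set0); [|right|].
apply: (ext g [set I | Gam (restr g I)]) => //; first by left.
move=> x Dx; have [Ax Agx _] := gD x Dx; split; [split=> // V|by []].
move=> xV; have xD : nbhs x D by apply: open_nbhs_nbhs; split=> //; case: oD.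
have : \forall y \near x^', [/\ V y, D y, ~ grid q y & ~ grid q (uapply g y)].
  near=> y; split.
  - by near: y; exact: nbhs_dnbhs.
  - by near: y; exact: nbhs_dnbhs.
  - by near: y; exact: ngrid_dnbhs.
  - by near: y; exact: ngrid_uapply_dnbhs.
move=> /filter_ex[y [Vy Dy ngy nggy]]; exists y; split=> //.
have [_ _ /(_ ngy nggy) gy] := gD y Dy.
by have [I [_ Iy GI]] := good_germ ngy nggy gy; exists I.
Unshelve. all: by end_near. Qed.

(** The intermediate point [uapply g1 x] may fall on the grid. Replace [x] by a nearby [y] with the
    same initial and final cells whose intermediate point is off the grid, and transfer goodness
    back by [good_idx]. *)
Lemma good_moves_comp : Defs.closed_comp good_moves.
Proof.
move=> g1 g2 D1 D2 /good_movesP[d1 h1] /good_movesP[d2 h2].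
have oC : open_interval_or_empty (D1 `&` uapply g1 @^-1` D2).
  case: d1 => [d1| ->]; last by right; rewrite set0I.
  case: d2 => [d2| ->]; last by right; rewrite preimage_set0 setI0.
  have [->|/set0P C0] := eqVneq (D1 `&` uapply g1 @^-1` D2) set0; first by right.
  left; apply: open_intervalI => //; exact: open_interval_preimage.
apply/good_movesP; split=> // x C1x; have [/= D1x D2x] := C1x.
have [Ax _ _] := h1 x D1x; have [_ Agx _] := h2 _ D2x.
rewrite ucompE; split=> // ngx nggx.
have nearC : nbhs x (D1 `&` uapply g1 @^-1` D2).
  case: oC => [[oC _ _]|C0]; last by rewrite C0 in C1x.
  by apply: open_nbhs_nbhs.
have : \forall y \near x^', [/\ (D1 `&` uapply g1 @^-1` D2) y,
    cell (idx x) y, cell (idx (uapply g2 (uapply g1 x))) (uapply (ucomp g2 g1) y)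
    & ~ grid q (uapply g1 y)].
  near=> y; split.
  - by near: y; exact: nbhs_dnbhs.
  - by near: y; apply: nbhs_dnbhs; apply: cell_near => //; exact: ngrid_cell.
  - near: y; apply: nbhs_dnbhs; apply: uapply_near; apply: cell_near => //.
    by rewrite ucompE; exact: ngrid_cell.
  - by near: y; exact: ngrid_uapply_dnbhs.
move=> /(@filter_ex _ _ (Proper_dnbhs_numFieldType x)) [y [Cy c1 c2 ng1]].
have [/= D1y D2y] := Cy.
have ngy := cell_ngrid q_gt0 c1; have ngcy := cell_ngrid q_gt0 c2.
apply: (@good_idx _ y); first exact: cell_idx c1.
  by rewrite (ucompE _ _ x); exact: cell_idx c2.
apply: good_comp => //; first by have [_ _] := h1 y D1y; apply.
by have [_ _] := h2 _ D2y; apply => //; rewrite -ucompE.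
Unshelve. all: by end_near. Qed.

Lemma good_moves_inv : closed_inv good_moves.
Proof.
move=> g D /good_movesP[oD gD]; apply/good_movesP; split.
  case: oD => [oD| ->]; last by right; rewrite image_set0.
  by left; exact: open_interval_image.
move=> _ [x Dx <-]; have [Ax Agx gx] := gD x Dx; rewrite uinvK; split=> //.
by move=> nggx ngx; apply: good_inv => //; exact: gx.
Qed.

(** Close to a point of the closure there is a point of the union with the same initial and final
    cells. *)
Lemma good_moves_extend : ax_extend A good_moves.
Proof.
move=> g F D hF oD sD; apply/good_movesP; split=> // x /sD[[clx Ax] Agx].
split=> // ngx nggx.
have cx := cell_near q_gt0 (ngrid_cell q_gt0 ngx).
have cgx := uapply_near (cell_near q_gt0 (ngrid_cell q_gt0 nggx)).
have [y [[I FI Iy] [/= cy cgy]]] := clx _ (filterI cx cgx).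
have /good_movesP[_ /(_ y Iy)[_ _ gy]] := hF I FI.
apply: (@good_idx _ y); [exact: cell_idx cy|exact: cell_idx cgy|].
by apply: gy; [exact: cell_ngrid cy|exact: cell_ngrid cgy].
Qed.

(** For large [i] the images of [x] under [gs i] and [g] share a cell, and by discreteness of the
    grid the parameter of [gs i] either equals that of [g] or is off the grid. In the first case the
    moves coincide; in the second goodness of [gs i] can only come from linked cells. *)
Lemma good_moves_lim : ax_lim good_moves.
Proof.
move=> gs g D oD hgs gs_g; apply/good_movesP; split; first by left.
have on i : good_on (gs i) D by have /good_movesP[] := hgs i.
move=> x Dx; have [Ax _ _] := on 0%N x Dx; split=> //.
  (* The point [uapply g x] lies in [A] because for large [i] it is the image under [gs i] of a
     point of [D]. *)
  have /(_ D)near_D : uapply (uinv (gs i)) (uapply g x) @[i --> \oo] --> x.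
    by rewrite -{2}(uinvK g x); apply: umove_cvg_at; exact: umove_cvg_uinv.
  have /near_D[N _ /(_ N (leqnn N)) DN] : nbhs x D.
    by apply: open_nbhs_nbhs; split=> //; case: oD.
  by have [_ + _] := on N _ DN; rewrite uinvKV.
move=> ngx nggx.
have near_cell : \forall i \near \oo, cell (idx (uapply g x)) (uapply (gs i) x).
  exact: umove_cvg_at gs_g _ (cell_near q_gt0 (ngrid_cell q_gt0 nggx)).
have near_par : \forall i \near \oo,
    param (gs i) != param g -> ~ grid q (param (gs i)).
  have [_ pc] := gs_g; exact: pc _ (ngrid_dnbhs q_gt0 (param g)).
have [tag_cvg _] := gs_g.
have [i [ci [pi_ ti]]] := filter_ex (filterI near_cell (filterI near_par tag_cvg)).
have [_ _ /(_ ngx (cell_ngrid q_gt0 ci)) gi] := on i x Dx.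
have [pE|/pi_ npi] := eqVneq (param (gs i)) (param g).
  suff -> : g = gs i by [].
  by move: pE ti; case: (gs i) (g) => [?|?] [?|?] //= ->.
by case: gi => [|[]//]; rewrite (cell_idx ci); left.
Qed.

Lemma ngrid_mvto (b : bool) (x y : R) : \forall z \near y^', ~ grid q (param (mvto b x z)).
Proof.
have := ngrid_uapply_dnbhs q_gt0 (if b then Translation x else Translation (- x)) y.
by apply: filterS => z; case: b => /=; rewrite ?(addrC z).
Qed.

(** Moving the target slightly within its cell takes the parameter of the type [b] move off the
    grid. Goodness then means that the two cells are linked, which does not depend on the type. *)
Lemma good_moves_kaleido_sub (b c : bool) D E : open_interval D -> open_interval E ->
  moves_tag b (D `*` E) `<=` good_moves -> moves_tag c (D `*` E) `<=` good_moves.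
Proof.
move=> oD oE hb.
have on x y : D x -> E y -> [/\ A x, A y & ~ grid q x -> ~ grid q y ->
    good (mvto b x y) x].
  move=> Dx Ey; set h := mvto b x y; pose I := D `&` uapply h @^-1` E.
  have Ix : I x by split=> //=; rewrite mvtoE.
  have oI : open_interval I.
    by apply: open_intervalI => //; [exact: open_interval_preimage|exists x].
  have : good_moves (restr h I).
    apply: hb; apply: moves_tag_restr; [by left|exact: is_reflection_mvto|].
    by move=> z [].
  by move=> /good_movesP[_ /(_ x Ix)]; rewrite mvtoE.
move=> m [[g [I [oI ->]]] /= gc /graph_restrS sI]; apply/good_movesP; split=> //.
move=> x /sI[/= Dx Egx]; have [Ax Agx _] := on _ _ Dx Egx; split=> // ngx nggx.
left; have : \forall y \near (uapply g x)^', [/\ E y, cell (idx (uapply g x)) y &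
    ~ grid q (param (mvto b x y))].
  near=> y; split.
  - near: y; apply: nbhs_dnbhs; apply: open_nbhs_nbhs; split=> //.
    by case: oE.
  - by near: y; apply: nbhs_dnbhs; apply: cell_near => //; exact: ngrid_cell.
  - by near: y; exact: ngrid_mvto.
move=> /(@filter_ex _ _ (Proper_dnbhs_numFieldType _))[y [Ey cy ngm]].
have [_ _ /(_ ngx (cell_ngrid q_gt0 cy)) [|[]//]] := on _ _ Dx Ey.
by rewrite mvtoE (cell_idx cy).
Unshelve. all: by end_near. Qed.

Lemma good_moves_closed : closed_move_semigroup A good_moves.
Proof.
split; split.
- by move=> _ [g [D [-> oD _]]]; exists g, D.
- exact: good_moves_comp.
- exact: good_moves_inv.
- move=> g D D' /good_movesP[_ gD] sD oD'; apply/good_movesP; split=> // x /sD.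
  exact: gD.
- move=> g F hF oF; apply/good_movesP; split; first by left.
  by move=> x [I /hF/good_movesP[_ gI] Ix]; exact: gI.
- exact: good_moves_extend.
- exact: good_moves_lim.
- by move=> D E oD oE; split; exact: good_moves_kaleido_sub.
Qed.

End GridSemigroup.

(** * The finite presentation *)

Section MaximalIntervals.
Variable R : realType.
Implicit Types (D E U J : set R).

Lemma open_interval_nbhs U (x : R) : nbhs x U ->
  exists I, [/\ open_interval I, I x & I `<=` U].
Proof.
move=> /nbhs_ballP[e /= e0 xU]; exists (ball x e); split=> //; last exact: ballxx.
by rewrite ball_itv; apply: open_interval_itv; lra.
Qed.

Lemma is_interval_bigcup (F : set (set R)) (x : R) :
  (forall I, F I -> is_interval I) -> (forall I, F I -> I x) ->
  is_interval (\bigcup_(I in F) I).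
Proof.
move=> iF Fx y z [I FI Iy] [J FJ Jz] w ywz.
have UIJ : is_interval (I `|` J).
  by apply: is_intervalU; [exact: iF|exact: iF|exists x; split; exact: Fx].
by have [Iw|Jw] := UIJ _ _ (or_introl Iy) (or_intror Jz) w ywz; [exists I|exists J].
Qed.

Lemma maximal_interval_sub U J I : maximal_interval U J -> is_interval I ->
  I `<=` U -> J `&` I !=set0 -> I `<=` J.
Proof.
move=> [iJ _ JU mJ] iI IU JI; rewrite -(mJ (J `|` I)).
- by move=> x Ix; right.
- exact: is_intervalU.
- by move=> x Jx; left.
- by move=> x [/JU|/IU].
Qed.

Lemma maximal_interval_eq U J I x : maximal_interval U J ->
  maximal_interval U I -> J x -> I x -> J = I.
Proof.
move=> mJ mI Jx Ix; have [iJ _ JU _] := mJ; have [iI _ IU _] := mI.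
by apply/seteqP; split; [apply: (maximal_interval_sub mI)|
  apply: (maximal_interval_sub mJ)] => //; exists x.
Qed.

Lemma open_maximal_interval U J : open U -> maximal_interval U J ->
  open_interval J.
Proof.
move=> oU mJ; have [iJ J0 JU _] := mJ; split=> //; rewrite openE => x Jx.
have [I [[oI iI _] Ix IU]] : exists I, [/\ open_interval I, I x & I `<=` U].
  by apply: open_interval_nbhs; apply: open_nbhs_nbhs; split=> //; exact: JU.
have IJ : I `<=` J by apply: (maximal_interval_sub mJ) => //; exists x.
by apply: filterS IJ _; apply: open_nbhs_nbhs.
Qed.

Lemma maximal_interval_ex U x : U x -> exists2 J, maximal_interval U J & J x.
Proof.
move=> Ux; pose F := [set I | [/\ is_interval I, I x & I `<=` U]].
have Fx : F [set x].
  split=> // [y z -> -> w|y ->//].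
  by rewrite -eq_le => /eqP ->.
exists (\bigcup_(I in F) I); last by exists [set x].
split.
- by apply: (@is_interval_bigcup _ x) => I [].
- by exists x; exists [set x].
- by move=> y [I [_ _ IU] /IU].
- move=> J iJ FJ JU; apply/seteqP; split=> // y Jy; exists J => //; split=> //.
  by apply: FJ; exists [set x].
Qed.

End MaximalIntervals.

(** * Intervals that are unions of cells and grid points *)

Section GridEndpoints.
Variables (R : realType) (q : nat).
Hypothesis q_gt0 : (0 < q)%N.
Implicit Types (D : set R).

Let Q_gt0 : 0 < q%:R :> R. Proof. by rewrite ltr0n. Qed.

(** If an endpoint were off the grid, its cell would meet [D] just inside, hence be contained in
    [D], and the open interval would contain its own endpoint. *)
Lemma grid_endpoints D : open_interval D -> D `<=` `]0, 1[%classic ->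
  (forall c, grid_cell q c `&` D !=set0 -> grid_cell q c `<=` D) ->
  endpoints_in (@grid R q `&` `[0, 1]%classic) D.
Proof.
move=> oD D01 cD; have [u [v [u0 uv v1 DE]]] := open_interval_bounded oD D01.
have Dmem y : D y <-> u < y < v by rewrite DE /= in_itv.
have gu : grid q u.
  apply: contrapT => /(ngrid_cell q_gt0) cu.
  suff : D u by move/Dmem; rewrite ltxx.
  apply: (cD (grid_idx q u)) => //.
  have : \forall y \near u^'+, [/\ grid_cell q (grid_idx q u) y, u < y & y < v].
    near=> y; split.
    - by near: y; apply: cvg_within; exact: cell_near.
    - by near: y; exact: nbhs_right_gt.
    - by near: y; exact: nbhs_right_lt.
  by move=> near_y; have [y [cy uy yv]] := @filter_ex _ _ (at_right_proper_filter u) _ near_y; exists y; split=> //; apply/Dmem; rewrite uy yv.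
have gv : grid q v.
  apply: contrapT => /(ngrid_cell q_gt0) cv.
  suff : D v by move/Dmem; rewrite ltxx andbF.
  apply: (cD (grid_idx q v)) => //.
  have : \forall y \near v^'-, [/\ grid_cell q (grid_idx q v) y, u < y & y < v].
    near=> y; split.
    - by near: y; apply: cvg_within; exact: cell_near.
    - by near: y; exact: nbhs_left_gt.
    - by near: y; exact: nbhs_left_lt.
  by move=> near_y; have [y [cy uy yv]] := @filter_ex _ _ (at_left_proper_filter v) _ near_y; exists y; split=> //; apply/Dmem; rewrite uy yv.
exists u, v; split=> //; split=> //; rewrite /= in_itv /=.
- by rewrite u0 ltW// (lt_le_trans uv).
- by rewrite v1 andbT ltW// (le_lt_trans u0).
Unshelve. all: by end_near. Qed.

Lemma finite_grid (a b : int) : finite_set (@grid R q `&` `[a%:~R, b%:~R]%classic).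
Proof.
pose f (i : nat) : R := (a * q%:Z + i%:Z)%:~R / q%:R.
apply: (@sub_finite_set _ _ (f @` `I_(absz (b - a)%R * q).+1)); last first.
  by apply: finite_image; exact: finite_II.
move=> x [[z ->]] /=; rewrite in_itv /= ler_pdivlMr// ler_pdivrMr//.
rewrite -![q%:R]/(q%:~R) -!intrM !ler_int => /andP[az zb].
exists (absz (z - a * q%:Z)%R); last first.
  by rewrite /f gez0_abs ?subr_ge0// addrC subrK.
have ab : a <= b.
  by rewrite -(ler_pM2r (_ : 0 < q%:Z)) ?(le_trans az)// ltz_nat.
by rewrite /= ltnS -lez_nat PoszM !gez0_abs ?subr_ge0// mulrBl lerD2r.
Qed.

End GridEndpoints.

(** * Components of linked cells and maximal moves *)

Section FinitePresentation.
Variables (R : realType) (q : nat).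
Hypothesis q_gt0 : (0 < q)%N.
Variables (A : set R) (Gam : set (tagged_map R)).
Hypothesis GamP : closed_move_semigroup A Gam.
Hypothesis Gam_good : Gam `<=` good_moves q A Gam.
Hypothesis A_open : open A.
Hypothesis A01 : A `<=` `]0, 1[%classic.
Implicit Types (D E : set R) (g : umove R) (a b c : int).

Local Notation cell := (@grid_cell R q).
Local Notation idx := (@grid_idx R q).
Local Notation germ := (@germ R Gam).
Local Notation cells_linked := (cells_linked q Gam).
Local Notation good := (good q Gam).

Lemma Gam_inv g D : Gam (restr g D) ->
  open_interval_or_empty D /\ good_on q A Gam g D.
Proof. by move=> /Gam_good/good_movesP. Qed.

Lemma germ_dom g x : germ g x -> A x /\ A (uapply g x).
Proof. by move=> [D [_ Dx /Gam_inv[_ /(_ x Dx)[]]]]. Qed.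

Lemma Gam_set0 g : Gam (restr g set0).
Proof.
by have [_ [_ _ ext _ _]] := GamP; apply: (ext g set0) => //; right.
Qed.

Lemma good_cell g x : ~ grid q x -> grid q (param g) -> good g x ->
  forall y, cell (idx x) y -> germ g y.
Proof.
move=> ngx gg [l|[]//] y cy; apply: (l _ (uapply g y)) => //.
by rewrite -cell_uapply_idx.
Qed.

Lemma maximal_move_sub g D E : maximal_move Gam (restr g D) -> open_interval D ->
  open_interval E -> D `&` E !=set0 -> (forall x, E x -> germ g x) -> E `<=` D.
Proof.
move=> [GD mD] oD oE DE gE.
have oU := open_intervalU oD oE DE.
have GU : Gam (restr g (D `|` E)).
  apply/(Gam_germP GamP) => // x [Dx|]; last exact: gE.
  exact: (iffLR (Gam_germP GamP _ oD)).
have e := mD _ GU (is_restriction_sub g (@subsetUl _ D E)).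
have [_ DU] : g = g /\ D `|` E = D by apply: restr_inj => //; case: oU.
by rewrite -[X in _ `<=` X]DU; exact: subsetUr.
Qed.

(** The union of all open intervals containing [D] on which [g] is in [Gam]; (continuation) applies
    as they share a point. *)
Lemma maximal_move_ex g D : Gam (restr g D) -> open_interval D ->
  exists E, [/\ D `<=` E, open_interval E & maximal_move Gam (restr g E)].
Proof.
move=> GD oD; pose F := [set E | [/\ D `<=` E, open_interval E & Gam (restr g E)]].
have FD : F D by split.
have DF : D `<=` \bigcup_(E in F) E by move=> x Dx; exists D.
have [_ _ [x Dx]] := oD.
have oF : open_interval (\bigcup_(E in F) E).
  split; last by exists x; exact: DF.
    by apply: bigcup_open => E [_ []].
  by apply: (@is_interval_bigcup _ _ x) => E [DE [_ iE _] _] //; exact: DE.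
exists (\bigcup_(E in F) E); split=> //; split.
  by have [_ [_ con _ _ _]] := GamP; apply: con => // E [].
move=> m' Gm'; have [[ens _ _] _] := GamP; have [h [E [oE m'E]]] := ens _ Gm'.
rewrite m'E in Gm' *; move=> rE; have [gh FE] := is_restriction_restr (ex_intro _ x (DF x Dx)) rE.
rewrite -gh in Gm' *; rewrite (_ : E = \bigcup_(E in F) E)//.
apply/seteqP; split=> // y Ey; exists E => //; split=> //.
  by move=> z /DF/FE.
by case: oE => // E0; rewrite E0 in Ey.
Qed.

(** Taking the interior keeps a grid point of [A] exactly when both adjacent cells are linked to
    [a]. *)
Definition component a : set R :=
  A `&` [set y | ~ grid q y -> cells_linked (idx y) a]^°.

Lemma component_open a : open (component a).
Proof. by apply: openI => //; exact: open_interior. Qed.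

Lemma component_linked a x y : component a x -> component a y ->
  ~ grid q x -> ~ grid q y -> cells_linked (idx x) (idx y).
Proof.
move=> [_ /interior_subset/= xa] [_ /interior_subset/= ya] ngx ngy.
apply: (cells_linked_trans q_gt0 GamP (xa ngx)).
by apply: (cells_linked_sym GamP); exact: ya ngy.
Qed.

(** A cell linked to [a] is linked to itself, so the identity has a germ at each of its points;
    germs live over [A], so the cell lies in [A]. *)
Lemma component_cell a c : cell c `&` component a !=set0 -> cell c `<=` component a.
Proof.
move=> [x [cx [Ax /interior_subset/= xa]]] y cy; split.
  have cc : cells_linked c c.
    have ca : cells_linked c a by rewrite -(cell_idx cx); apply: xa; exact: cell_ngrid cx.
    apply: (cells_linked_trans q_gt0 GamP ca); apply: (cells_linked_sym GamP).
    exact: ca.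
  have [//] : A y /\ A (uapply (Translation 0) y).
  by apply: germ_dom; apply: (cc y y) => //=; rewrite addr0.
have := cell_near q_gt0 cy; apply: filterS => z cz ngz.
by rewrite (cell_idx cz) -(cell_idx cx); apply: xa; exact: cell_ngrid cx.
Qed.

Lemma component_sub01 a : component a `<=` `]0, 1[%classic.
Proof. by move=> x [/A01]. Qed.

Lemma maximal_interval_endpoints a J : maximal_interval (component a) J ->
  endpoints_in (@grid R q `&` `[0, 1]%classic) J.
Proof.
move=> mJ; have [_ _ JU _] := mJ; apply: grid_endpoints => //.
- by apply: open_maximal_interval mJ; exact: component_open.
- exact: subset_trans JU (@component_sub01 a).
- move=> c [x [cx Jx]]; have [_ ic _] := open_interval_cell R q_gt0 c.
  apply: (maximal_interval_sub mJ) => //; last by exists x.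
  by apply: component_cell; exists x; split=> //; exact: JU.
Qed.

Lemma component_finite_union a : finite_union_disjoint_intervals (component a).
Proof.
exists [set J | maximal_interval (component a) J]; split.
- pose P := (@grid R q `&` `[0, 1]%classic).
  have fP : finite_set P by exact: (finite_grid R q_gt0 0 1).
  apply: (@sub_finite_set _ _ ((fun p : R * R => `]p.1, p.2[%classic) @` (P `*` P))).
    move=> J /maximal_interval_endpoints[u [v [_ -> Pu Pv]]].
    by exists (u, v).
  by apply: finite_image; exact: finite_setX.
- by move=> J mJ; apply: open_maximal_interval mJ; exact: component_open.
- by move=> I J mI mJ [x [Ix Jx]]; exact: maximal_interval_eq mI mJ Ix Jx.
- apply/seteqP; split=> [x /maximal_interval_ex[J mJ Jx]|x [J [_ _ JU _] /JU//]].
  by exists J.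
Qed.

Lemma grid_param g x : grid q x -> grid q (uapply g x) -> grid q (param g).
Proof.
case: g => [t|r] [z /= ->] [z' zE]; [exists (z' - z)|exists (z' + z)].
  by rewrite intrB mulrBl -zE; ring.
by rewrite intrD mulrDl -zE; ring.
Qed.

(** With the parameter off the grid, goodness always means linked cells. Hence every cell met near
    [uapply g x] is linked to that of [x], even if this image is a grid point. *)
Lemma component_ngrid g D x : Gam (restr g D) -> open_interval D ->
  ~ grid q (param g) -> D x -> ~ grid q x ->
  component (idx x) x /\ component (idx x) (uapply g x).
Proof.
move=> /Gam_inv[_ gD] [oD _ _] ngg Dx ngx; have [Ax Agx _] := gD x Dx.
have near_gx : \forall w \near uapply g x,
    ~ grid q w -> cells_linked (idx w) (idx x).
  have nD : \forall z \near x, (D `&` cell (idx x)) z.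
    apply: filterI; first exact: open_nbhs_nbhs.
    by apply: cell_near => //; exact: ngrid_cell.
  rewrite -{1}(uinvK g x) in nD; apply: filterS (uapply_near nD) => w [Dw cw] ngw.
  have [_ _] := gD _ Dw; rewrite uinvKV => /(_ (cell_ngrid q_gt0 cw) ngw)[|[]//].
  by rewrite uinvKV (cell_idx cw) => l; apply: (cells_linked_sym GamP); exact: l.
split; split=> //.
(* Going to the cell of [w] and back links the cell of [x] to itself. *)
have [w [wx ngw]] : exists w, (~ grid q w -> cells_linked (idx w) (idx x)) /\
    ~ grid q w.
  exact: (@filter_ex _ _ (Proper_dnbhs_numFieldType (uapply g x)) _
    (filterI (nbhs_dnbhs near_gx) (ngrid_dnbhs q_gt0 _))).
apply: filterS (cell_near q_gt0 (ngrid_cell q_gt0 ngx)) => z cz _.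
rewrite (cell_idx cz); apply: (cells_linked_trans q_gt0 GamP _ (wx ngw)).
by apply: (cells_linked_sym GamP); exact: wx ngw.
Qed.

(** If [x] is a grid point, its image is not, since the parameter is off the grid; the inverse move
    then reduces to the previous case. *)
Lemma component_ngrid_param g D x : Gam (restr g D) -> open_interval D ->
  ~ grid q (param g) -> D x ->
  exists2 y, A y & component (idx y) x /\ component (idx y) (uapply g x).
Proof.
move=> GD oD ngg Dx; have [_ /(_ x Dx)[Ax Agx _]] := Gam_inv GD.
have [gx|ngx] := EM (grid q x); last first.
  by exists x => //; exact: component_ngrid GD oD ngg Dx ngx.
have nggx : ~ grid q (uapply g x) by move=> /(grid_param gx).
have [[_ _ inv] _] := GamP.
have := @component_ngrid (uinv g) (uapply g @` D) (uapply g x).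
rewrite uinvK => /(_ (inv _ _ GD) (open_interval_image g oD))[|||c1 c2] //.
- by move=> /(grid_uinv); rewrite uinv_inv.
- by exists (uapply g x).
Qed.

(** The indices below [q] are those of the cells in the unit interval; [set0] contributes the two
    empty moves. *)
Definition components : set (set R) := [set U | U = set0 \/
  exists2 i : nat, (i < q)%N & U = component i%:Z].

Lemma idx_lt x : A x -> exists2 i : nat, (i < q)%N & idx x = i%:Z.
Proof.
move=> /A01; rewrite /= in_itv /= => /andP[x0 x1].
have Q0 : 0 < q%:R :> R by rewrite ltr0n.
have i0 : 0 <= idx x by rewrite /grid_idx floor_ge0 mulr_ge0 ?ltW.
exists (absz (idx x)); last by rewrite gez0_abs.
rewrite -ltz_nat gez0_abs// /grid_idx floor_lt_int.
by rewrite -[X in _ < X]mul1r ltr_pM2r.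
Qed.

Lemma components_sub : moves_list components `<=` Gam.
Proof.
move=> m [U [->|[i _ ->]]] mU.
  have [g [D [_ mE]]] : is_move m by case: mU => -[].
  have [D0 mD] : D = set0 /\ m = restr g D.
    split=> //; apply/seteqP; split=> // x Dx.
    by case: mU => -[_ _]; rewrite mE => /graph_restrS/(_ x Dx)[].
  by rewrite mD D0; exact: Gam_set0.
apply: (good_moves_sub q_gt0 GamP).
have [g [D [oD mE]]] : is_move m by case: mU => -[].
exists g, D; split=> // x Dx.
have [/= Ux Ugx] : (component i%:Z `*` component i%:Z) (x, uapply g x).
  by case: mU => -[_ _]; rewrite mE => /graph_restrS/(_ x Dx).
split; [by case: Ux|by case: Ugx|move=> ngx nggx; left].
exact: component_linked Ux Ugx ngx nggx.
Qed.

(** Around each point of [D] the move stays within the square of one component; (continuation) glues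
    these pieces. *)
Lemma ngrid_param_join g D : Gam (restr g D) -> open_interval D ->
  ~ grid q (param g) -> join (moves_list components) (restr g D).
Proof.
move=> GD oD ngg G [[ens res con] sG].
pose F := [set I : set R | G (restr g I) /\ I `<=` D].
suff DE : D = \bigcup_(I in F) I.
  by rewrite DE; apply: con => [I []//|]; rewrite -DE.
apply/seteqP; split=> [x Dx|x [I [_ ID] /ID//]].
have [y Ay [cx cgx]] := component_ngrid_param GD oD ngg Dx.
have : \forall z \near x, [/\ D z, component (idx y) z &
    component (idx y) (uapply g z)].
  near=> z; split.
  - by near: z; apply: open_nbhs_nbhs; split=> //; case: oD.
  - by near: z; apply: open_nbhs_nbhs; split=> //; exact: component_open.
  - near: z; apply: uapply_near; apply: open_nbhs_nbhs.
    by split=> //; exact: component_open.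
move=> /open_interval_nbhs[I [oI Ix Isub]]; exists I => //; split; last first.
  by move=> z /Isub[].
apply: sG; exists (component (idx y)).
  by right; have [i iq ->] := idx_lt Ay; exists i.
have mI : moves_tag (is_reflection g) (component (idx y) `*` component (idx y)) (restr g I).
  by apply: moves_tag_restr => //; [left|move=> z /Isub[]].
by case: (is_reflection g) mI => mI; [right|left].
Unshelve. all: by end_near. Qed.

Lemma finite_components : finite_set components.
Proof.
have -> : components = set0 |` ((fun i : nat => component i%:Z) @` `I_q).
  apply/seteqP; split=> [U [->|[i iq ->]]|U [->|[i iq <-]]].
  - by left.
  - by right; exists i.
  - by left.
  - by right; exists i.
by rewrite finite_setU; split=> //; apply: finite_image; exact: finite_II.
Qed.

Definition presentation_moves : set (tagged_map R) := [set m |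
  maximal_move Gam m /\ ~ join (moves_list components) m /\
  exists g D, open_interval D /\ m = restr g D].

(** The parameter is on the grid, for otherwise the components would generate the move. A grid move
    that is good at one point has germs on the whole cell, so by maximality [D] contains every cell
    it meets. The range of the parameter holds because [D] and its image lie in the unit
    interval. *)
Lemma presentation_movesP g D : open_interval D ->
  presentation_moves (restr g D) -> endpoints_in (@grid R q `&` `[0, 1]%classic) D
  /\ (@grid R q `&` param_range g) (param g).
Proof.
move=> oD [mD [njD _]]; have GD := mD.1; have [_ gD] := Gam_inv GD.
have gg : grid q (param g).
  by apply: contrapT => ngg; apply: njD; exact: ngrid_param_join.
split; last split=> //.
  apply: grid_endpoints => //; first by move=> x /gD[/A01].
  move=> c [x [cx Dx]]; apply: (maximal_move_sub mD) => //.
  - exact: open_interval_cell.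
  - by exists x.
  - have ngx := cell_ngrid q_gt0 cx; rewrite -(cell_idx cx).
    apply: good_cell => //; have [_ _] := gD x Dx; apply=> //.
    by move=> /(grid_uapply q_gt0 gg).
have [_ _ [x /gD[/A01 + /A01 + _]]] := oD.
by case: g {mD njD GD gD gg} => t /=; rewrite !in_itv /= => /andP[? ?] /andP[? ?];
  apply/andP; split; lra.
Qed.

Lemma finite_presentation_moves : finite_set presentation_moves.
Proof.
(* One bounded interval containing the endpoints and both parameter ranges. *)
pose P := @grid R q `&` `[(-1)%:~R, 2%:~R]%classic.
have fP : finite_set P by exact: finite_grid.
pose F (h : R -> umove R) (p : R * (R * R)) := restr (h p.1) `]p.2.1, p.2.2[%classic.
have fF h : finite_set (F h @` (P `*` (P `*` P))).
  by apply: finite_image; apply: finite_setX => //; exact: finite_setX.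
apply: (@sub_finite_set _ _ (F (@Translation R) @` (P `*` (P `*` P)) `|`
    F (@Reflection R) @` (P `*` (P `*` P)))); last by rewrite finite_setU.
move=> m Wm; have [_ [_ [g [D [oD mE]]]]] := Wm; rewrite mE in Wm *.
have [[u [v [_ -> [gu u01] [gv v01]]]] [gg gr]] := presentation_movesP oD Wm.
have Pe w : grid q w -> `[0, 1]%classic w -> P w.
  by move=> gw; rewrite /= !in_itv /= => /andP[? ?]; split=> //; rewrite /= in_itv /=; lra.
have Pu := Pe _ gu u01; have Pv := Pe _ gv v01.
have Pg : P (param g).
  split=> //; move: gr; case: (g) => t /=; rewrite !in_itv /= => /andP[? ?]; lra.
by case: g Pg {Wm mE gg gr} => t Pt; [left|right]; exists (t, (u, v)).
Qed.

(** Every nonempty move restricts a maximal one, which is either generated by the components or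
    among [presentation_moves]. *)
Lemma Gam_join : Gam = join (presentation_moves `|` moves_list components).
Proof.
have [[ens _ _] [res con _ _ _]] := GamP; apply/seteqP; split=> m; last first.
  by apply; split=> // m' [[[]]//|/components_sub].
move=> Gm; have [g [D [oD mE]]] := ens _ Gm; rewrite mE in Gm *.
case: oD Gm => [oD|->] Gm; last first.
  apply: sub_gen_smallest; right; exists set0; first by left.
  have mI : moves_tag (is_reflection g) (set0 `*` set0 : set (R * R)) (restr g set0).
    by apply: moves_tag_restr => //; right.
  by case: (is_reflection g) mI => mI; [right|left].
have [E [DE oE mE']] := maximal_move_ex Gm oD.
suff jE : join (presentation_moves `|` moves_list components) (restr g E).
  by move=> G GP; have [[_ r _] _] := GP; apply: (r g E) => //; [exact: jE|left].
have [jE|njE] := EM (join (moves_list components) (restr g E)).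
  move=> G [GP sG]; apply: jE; split=> // m' m'C; apply: sG; right.
  exact: m'C.
by apply: sub_gen_smallest; left; split=> //; split=> //; exists g, E.
Qed.

Lemma grid_finite_presentation :
  let G01 := @grid R q `&` `[0, 1]%classic in
  exists (W : set (tagged_map R)) (C : set (set R)),
    [/\ finite_presentation Gam W C,
        reduced_form Gam W C,
        (forall (g : umove R) (D : set R), open_interval D -> W (restr g D) ->
           endpoints_in G01 D /\ (@grid R q `&` param_range g) (param g))
      & (forall U J : set R, C U -> maximal_interval U J ->
           endpoints_in G01 J)].
Proof.
have [[ens _ _] [res con _ _ kal]] := GamP.
exists presentation_moves, components; split.
- split; split=> //.
  + by move=> m [[/ens]].
  + exact: finite_presentation_moves.
  + exact: finite_components.
  + move=> U [->|[i _ ->]]; last exact: component_finite_union.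
    by exists set0; split=> //; rewrite bigcup_set0.
  + exact: Gam_join.
- by move=> m [mm [nj _]].
- by move=> g D; exact: presentation_movesP.
- move=> U J [->|[i _ ->]]; last exact: maximal_interval_endpoints.
  by move=> [_ [x Jx] /(_ x Jx)].
Qed.

End FinitePresentation.

(** * Piecewise linear functions and initial moves *)

Section Subdivisions.
Variables (R : realType) (n : nat) (x : nat -> R).
Hypothesis x_sub : subdivision n x.

Lemma subdivision_lt i j : (i < j)%N -> (j <= n)%N -> x i < x j.
Proof.
have [_ _ xS] := x_sub; elim: j => // j IH; rewrite ltnS leq_eqVlt.
move=> /orP[/eqP -> jn|ij jn]; first exact: xS.
by apply: lt_trans (xS j jn); apply: IH => //; exact: ltnW.
Qed.

Lemma subdivision_bounds i : (i < n)%N -> 0 <= x i < 1.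
Proof.
have [x0 xn _] := x_sub; move=> i_n; rewrite -xn subdivision_lt// andbT.
by rewrite -x0; case: i i_n => [|i] i_n//; rewrite ltW// subdivision_lt// ltnW.
Qed.

Lemma subdivision_consecutive (y : R) : exists a b,
  consecutive (breakpoints n x) a b /\ a <= y < b.
Proof.
have [x0 xn xS] := x_sub.
pose z := Num.floor y; have zy : z%:~R <= y := floor_le y.
have yz : y < z%:~R + 1 by have := floorD1_gt y; rewrite intrD.
(* The right end is the first subdivision point beyond the fractional part of [y]. *)
have ex_j : exists j, y - z%:~R < x j by exists n; rewrite xn; lra.
have [j jP jmin] := ex_minnP ex_j.
have j0 : (0 < j)%N.
  by rewrite lt0n; apply/eqP => j0; move: jP; rewrite j0 x0; lra.
have jn : (j <= n)%N by apply: jmin; rewrite xn; lra.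
have jE : j = j.-1.+1 by rewrite prednK.
have jpn : (j.-1 < n)%N by rewrite prednK.
have jp : x j.-1 <= y - z%:~R.
  by rewrite leNgt; apply/negP => /jmin; rewrite leqNgt prednK// leqnn.
exists (x j.-1 + z%:~R), (x j + z%:~R); split; last by apply/andP; split; lra.
split.
- by exists j.-1, z.
- move: jn; rewrite leq_eqVlt => /orP[/eqP jn|jn]; last by exists j, z.
  (* Breakpoints use indices below [n], so the last point of one period is written as the first of
     the next. *)
  exists 0%N, (z + 1); rewrite jn xn x0 intrD; split; last by ring.
  by rewrite -jn.
- by rewrite ltrD2r subdivision_lt// ltn_predL.
- move=> _ [i [k [i_n ->]]] /andP[h1 h2].
  have /andP[xi0 xi1] := subdivision_bounds i_n.
  have /andP[xp0 xp1] := subdivision_bounds jpn.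
  have xj1 : x j <= 1.
    by move: jn; rewrite -xn leq_eqVlt => /orP[/eqP->//|jn]; rewrite ltW// subdivision_lt.
  have kz : k = z.
    apply/eqP; rewrite eq_le -!ltzD1 -!(ltr_int R) !intrD.
    by apply/andP; split; lra.
  move: h1 h2; rewrite kz !ltrD2r => h1 h2.
  have [ij|ji] := ltnP i j.
    have : (i <= j.-1)%N by rewrite -ltnS prednK.
    rewrite leq_eqVlt => /orP[/eqP ij'|ij']; first by rewrite ij' ltxx in h1.
    by have := subdivision_lt ij' (ltnW jpn); rewrite ltNge ltW.
  move: ji; rewrite leq_eqVlt => /orP[/eqP ij'|ij']; first by rewrite ij' ltxx in h2.
  by have := subdivision_lt ij' (ltnW i_n); rewrite ltNge ltW.
Qed.

(** The consecutive breakpoints around a point of the cell are grid points; scaled by [q] they are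
    integers, so the whole cell lies between them. *)
Lemma piecewise_linear_cell (q : nat) (pi : R -> R) : (0 < q)%N ->
  piecewise_linear (breakpoints n x) pi -> breakpoints n x `<=` @grid R q ->
  forall a, exists s c, forall y, grid_cell q a y -> pi y = s * y + c.
Proof.
move=> q_gt0 pwl Bg a; have [y0 cy0] := cell_ex R q_gt0 a.
have [u [v [uv /andP[uy yv]]]] := subdivision_consecutive y0.
have Q0 : 0 < q%:R :> R by rewrite ltr0n.
have [Bu Bv _ _] := uv.
have /(gridP q_gt0)[k kE] := Bg _ Bu; have /(gridP q_gt0)[l lE] := Bg _ Bv.
have [|s [c sc]] := pwl `]u, v[%classic; first by apply: Or33; exists u, v.
exists s, c => y /andP[ay ya]; apply: sc; rewrite /= in_itv /=.
move: cy0 => /andP[ay0 ya0].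
rewrite -(ltr_pM2r Q0 u) -(ltr_pM2r Q0 y) kE lE.
apply/andP; split.
- apply: le_lt_trans ay; rewrite ler_int -ltzD1 -(ltr_int R) intrD.
  by apply: le_lt_trans ya0; rewrite -kE ler_pM2r.
- apply: (lt_le_trans ya); rewrite -intrD1 ler_int lezD1 -(ltr_int R).
  by apply: (lt_trans ay0); rewrite -lE ltr_pM2r.
Qed.

End Subdivisions.

(** * The open set where the function is continuous *)

Section ContinuityDomain.
Variables (R : realType) (pi : R -> R).

Lemma continuity_domain_open : open (continuity_domain pi).
Proof. by apply: bigcup_open => U []. Qed.

Lemma continuity_domain_sub01 : continuity_domain pi `<=` `]0, 1[%classic.
Proof. by move=> x [U [_ U01 _] /U01]. Qed.

Lemma continuity_domain_cell (q : nat) (x : R) : (0 < q)%N ->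
  (forall a, exists s c, forall y, grid_cell q a y -> pi y = s * y + c) ->
  0 < x < 1 -> ~ grid q x -> grid_cell q (grid_idx q x) `<=` continuity_domain pi.
Proof.
move=> q_gt0 aff /andP[x0 x1] /(ngrid_cell q_gt0)/andP[ax xa] z cz.
have Q0 : 0 < q%:R :> R by rewrite ltr0n.
exists (grid_cell q (grid_idx q x)) => //; have [oC _ _] := open_interval_cell R q_gt0 (grid_idx q x).
split=> //.
- move=> y /andP[ay ya]; rewrite /= in_itv /=.
  rewrite -(ltr_pM2r Q0 0) -(ltr_pM2r Q0 y) mul0r mul1r; apply/andP; split.
    apply: le_lt_trans ay; rewrite (_ : 0 = 0%:~R)// ler_int -ltzD1 -(ltr_int R).
    by rewrite intrD; apply: lt_trans xa; rewrite mulr_gt0.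
  apply: (lt_le_trans ya); rewrite -[q%:R]/(q%:~R) -intrD1 ler_int lezD1 -(ltr_int R).
  by apply: (lt_trans ax); rewrite -[X in _ < X]mul1r ltr_pM2r.
- rewrite continuous_open_subspace// => y; rewrite inE => cy.
  have [s [c sc]] := aff (grid_idx q x).
  have h : s * w + c @[w --> y] --> s * y + c.
    by apply: cvgD; [apply: cvgM; [exact: cvg_cst|exact: cvg_id]|exact: cvg_cst].
  rewrite /continuous_at (sc _ cy); apply: cvg_trans h; apply: near_eq_cvg.
  by apply: filterS (cell_near q_gt0 cy) => w /sc ->.
Qed.

End ContinuityDomain.

(** * Zeros of the subadditivity slack *)

Section InitialMoves.
Variables (R : realType) (q : nat) (pi : R -> R).
Hypothesis q_gt0 : (0 < q)%N.
Hypothesis pi_affine : forall a : int,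
  exists s c, forall y, grid_cell q a y -> pi y = s * y + c.
Hypothesis delta_ge0 : forall x y, 0 <= delta pi x y.
Implicit Types (D E : set R) (g : umove R) (a b c : int).

Let A := continuity_domain pi.
Let Gam := clsemi A (initial_ensemble pi).

Local Notation cell := (@grid_cell R q).
Local Notation idx := (@grid_idx R q).
Local Notation germ := (@germ R Gam).
Local Notation linked := (linked Gam).
Local Notation cells_linked := (cells_linked q Gam).

Let Q_gt0 : 0 < q%:R :> R. Proof. by rewrite ltr0n. Qed.

Lemma initial_ensemble_move : ensemble (initial_ensemble pi).
Proof.
move=> m [[g ->]|[g [D [[oD _ _ _] ->]]]|[g [D [[oD _ _ _] ->]]]].
- by exists g, set0; split=> //; right.
- by exists g, D; split=> //; left.
- by exists (uinv g), (uapply g @` D); split=> //; left; exact: open_interval_image.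
Qed.

Lemma clsemi_initial_closed : closed_move_semigroup A Gam.
Proof. exact: clsemi_closed initial_ensemble_move. Qed.

Let GamP := clsemi_initial_closed.

Definition mv (b : bool) (s : R) : umove R :=
  if b then Reflection s else Translation s.

Lemma mv_param g : mv (is_reflection g) (param g) = g.
Proof. by case: g. Qed.

Definition move_delta g x : R :=
  match g with Translation t => delta pi x t | Reflection r => delta pi x (r - x) end.

Lemma move_delta_ge0 g x : 0 <= move_delta g x.
Proof. by case: g => t; exact: delta_ge0. Qed.

(** The range condition on the parameter follows from [x] and its image lying in the unit
    interval. *)
Lemma initial_gam g D : open_interval D ->
  (forall x, D x -> A x /\ A (uapply g x)) ->
  (forall x, D x -> move_delta g x = 0) \/
  (forall x, D x ->
     move_delta (mv (is_reflection g) s) x @[s --> (param g)^'+] --> (0 : R) \/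
     move_delta (mv (is_reflection g) s) x @[s --> (param g)^'-] --> (0 : R)) ->
  Gam (restr g D).
Proof.
move=> oD DA gD; apply: sub_gen_smallest; apply: Or32; exists g, D; split=> //.
split=> //; [by move=> x /DA[]|by move=> _ [x /DA[_ ?] <-]|].
have [_ _ [x /DA[/continuity_domain_sub01 + /continuity_domain_sub01]]] := oD.
rewrite /= !in_itv /= => /andP[? ?].
by case: g gD {DA} => t /= gD /andP[? ?]; split=> //; apply/andP; split; lra.
Qed.

Lemma cell_sub_domain x : A x -> ~ grid q x -> cell (idx x) `<=` A.
Proof.
move=> /continuity_domain_sub01; rewrite /= in_itv /= => x01 ngx.
exact: continuity_domain_cell.
Qed.

(** Pairs of source and target for which all three arguments of [pi] in the slack lie in fixed
    cells, so that the slack is affine there. *)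
Definition move_cell (b : bool) a a' c : set (R * R) :=
  [set p | [/\ cell a p.1, cell a' p.2 & cell c (param (mvto b p.1 p.2))]].

Lemma move_delta_affine (b : bool) a a' c : exists al be ga : R,
  forall p, move_cell b a a' c p ->
    move_delta (mvto b p.1 p.2) p.1 = al * p.1 + be * p.2 + ga.
Proof.
have [s1 [c1 h1]] := pi_affine a; have [s2 [c2 h2]] := pi_affine a'.
have [s3 [c3 h3]] := pi_affine c.
case: b.
  exists (s1 - s3), (s2 - s3), (c1 + c2 - c3) => -[u v] [/= cu cv cs].
  rewrite /delta (h1 _ cu) (_ : u + v - u = v); last by ring.
  by rewrite (h2 _ cv) (h3 _ cs); ring.
exists (s1 - s3), (s3 - s2), (c1 + c3 - c2) => -[u v] [/= cu cv cs].
rewrite /delta (h1 _ cu) (_ : u + (v - u) = v); last by ring.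
by rewrite (h2 _ cv) (h3 _ cs); ring.
Qed.

Lemma cell_near_line a x d : cell a x -> \forall e \near 0^'+, cell a (x - e * d).
Proof.
move=> cx; have h : x - e * d @[e --> 0^'+] --> x - 0 * d.
  apply: cvgB; first exact: cvg_cst.
  by apply: cvgM; [exact: cvg_within|exact: cvg_cst].
by rewrite mul0r subr0 in h; exact: h _ (cell_near q_gt0 cx).
Qed.

(** A nonnegative affine function vanishing at an interior point vanishes: a small step from [p0]
    away from [p] gives [- e] times the value at [p]. *)
Lemma move_cell_zero (b : bool) a a' c p0 p : move_cell b a a' c p0 ->
  move_cell b a a' c p -> move_delta (mvto b p0.1 p0.2) p0.1 = 0 ->
  move_delta (mvto b p.1 p.2) p.1 = 0.
Proof.
have [al [be [ga aff]]] := move_delta_affine b a a' c.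
case: p0 p => [x y] [u v] cxy cuv; rewrite (aff _ cxy) /= => xy0.
have [/= cx cy cs] := cxy.
pose d := param (mvto b u v) - param (mvto b x y).
have near_e : \forall e \near 0^'+,
    move_cell b a a' c (x - e * (u - x), y - e * (v - y)) /\ 0 < e.
  near=> e; split; last by near: e; exact: nbhs_right_gt.
  split=> /=.
  - by near: e; exact: cell_near_line.
  - by near: e; exact: cell_near_line.
  - rewrite (_ : param _ = param (mvto b x y) - e * d).
      by near: e; exact: cell_near_line.
    by rewrite /d; case: (b) => /=; ring.
have [e [ce e0]] := @filter_ex _ _ (at_right_proper_filter 0) _ near_e.
have := move_delta_ge0 (mvto b (x - e * (u - x)) (y - e * (v - y))) (x - e * (u - x)).
rewrite (aff _ ce) /=.
have := move_delta_ge0 (mvto b u v) u; rewrite (aff _ cuv) /= => uv0.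
rewrite (_ : _ + ga = (1 + e) * (al * x + be * y + ga) - e * (al * u + be * v + ga));
  last by ring.
rewrite xy0 mulr0 sub0r oppr_ge0 pmulr_rle0// => uv1.
by apply/eqP; rewrite eq_le uv0 uv1.
Unshelve. all: by end_near. Qed.

(** Apply (kaleido) to a small square around [p]. Side radius [e / 2] moves the parameter, a sum or
    difference of coordinates, by less than [e]. *)
Lemma move_cell_linked (b : bool) a a' c p :
  (forall p, move_cell b a a' c p -> germ (mvto b p.1 p.2) p.1) ->
  move_cell b a a' c p -> linked p.1 p.2.
Proof.
case: p => x y gp [/= cx cy cs].
have [e /= e0 es] := iffLR (nbhs_ballP _ _) (cell_near q_gt0 cs).
have oball z : open_interval (ball z (e / 2) : set R).
  by rewrite ball_itv; apply: open_interval_itv; lra.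
have bz z : ball z (e / 2) z by apply: ballxx; lra.
apply: (@linked_kaleido _ _ _ GamP b (cell a `&` ball x (e / 2))
    (cell a' `&` ball y (e / 2))); [| | |by []|by []].
- by apply: open_intervalI => //; [exact: open_interval_cell|exists x].
- by apply: open_intervalI => //; [exact: open_interval_cell|exists y].
- move=> u v [cu]; rewrite ball_itv /= in_itv /= => /andP[u1 u2].
  move=> [cv]; rewrite ball_itv /= in_itv /= => /andP[v1 v2].
  apply: (gp (u, v)); split=> //=; apply: es; rewrite ball_itv /= in_itv /=.
  by case: (b) => /=; apply/andP; split; lra.
Qed.

Lemma cell_frac a (w : R) : 0 < w < 1 -> cell a ((a%:~R + w) / q%:R).
Proof. by move=> /andP[? ?]; rewrite /grid_cell /= divfK ?gt_eqF//; apply/andP; split; lra. Qed.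

(* In the normalised coordinates (p, w) of the square cell a x cell a', the set
   move_cell is one of the triangles p < w, w < p, p + w < 1, p + w > 1;
   three steps inside the triangle join any two columns of the square. *)
Lemma cells_linked_of_germs (b : bool) a a' c p0 :
  (forall p, move_cell b a a' c p -> germ (mvto b p.1 p.2) p.1) ->
  move_cell b a a' c p0 -> cells_linked a a'.
Proof.
move=> gp [+ + +]; case: p0 => x0 y0 /= /andP[x01 x02] /andP[y01 y02] /andP[s1 s2].
suff tri (x y : R) : cell a x -> cell a' y -> exists w1 p1 : R,
    [/\ 0 < w1 < 1, 0 < p1 < 1,
     cell c (param (mvto b x ((a'%:~R + w1) / q%:R))),
     cell c (param (mvto b ((a%:~R + p1) / q%:R) ((a'%:~R + w1) / q%:R))) &
     cell c (param (mvto b ((a%:~R + p1) / q%:R) y))].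
  move=> x y cx cy; have [w1 [p1 [/(cell_frac a') cw /(cell_frac a) cp k1 k2 k3]]] := tri x y cx cy.
  have l1 := @move_cell_linked b a a' c (_, _) gp (And3 cx cw k1).
  have l2 := @move_cell_linked b a a' c (_, _) gp (And3 cp cw k2).
  have l3 := @move_cell_linked b a a' c (_, _) gp (And3 cp cy k3).
  apply: (linked_trans GamP l1); apply: (linked_trans GamP _ l3).
  exact: (linked_sym GamP l2).
move=> /andP[x1 x2] /andP[y1 y2].
case: b gp s1 s2 => /= _; rewrite ?mulrDl ?mulrBl => s1 s2.
- have [ca|ca] : c = a + a' \/ c = a + a' + 1.
    have : a + a' <= c by rewrite -ltzD1 -(ltr_int R) !intrD; lra.
    rewrite le_eqVlt => /orP[/eqP->|h]; [by left|right].
    apply/eqP; rewrite eq_le -ltzD1 -(ltr_int R) !intrD lezD1 h andbT; lra.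
  (* In all four cases [w1] is the midpoint of the slice of the triangle over [x], and [p1] that of
     the slice at height [y]. *)
  + exists ((1 - (x * q%:R - a%:~R)) / 2), ((1 - (y * q%:R - a'%:~R)) / 2).
    by rewrite /grid_cell /= !mulrDl !divfK ?gt_eqF// ca !intrD; split; apply/andP; split; lra.
  + exists (1 - (x * q%:R - a%:~R) / 2), (1 - (y * q%:R - a'%:~R) / 2).
    by rewrite /grid_cell /= !mulrDl !divfK ?gt_eqF// ca !intrD; split; apply/andP; split; lra.
- have [ca|ca] : c = a' - a \/ c = a' - a - 1.
    have : c <= a' - a by rewrite -ltzD1 -(ltr_int R) !(intrB, intrD); lra.
    rewrite le_eqVlt => /orP[/eqP->|h]; [by left|right].
    apply/eqP; rewrite eq_le lerBrDr lezD1 h -ltzD1 -(ltr_int R) !(intrB, intrD); lra.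
  + exists ((x * q%:R - a%:~R + 1) / 2), ((y * q%:R - a'%:~R) / 2).
    by rewrite /grid_cell /= !mulrBl !divfK ?gt_eqF// ca !intrB; split; apply/andP; split; lra.
  + exists ((x * q%:R - a%:~R) / 2), ((y * q%:R - a'%:~R + 1) / 2).
    by rewrite /grid_cell /= !mulrBl !divfK ?gt_eqF// ca !intrB; split; apply/andP; split; lra.
Qed.

(** The zero lies inside a [move_cell], so the slack vanishes on all of it and every move through it
    is initial. *)
Lemma delta_zero_linked g x : A x -> A (uapply g x) -> ~ grid q x ->
  ~ grid q (uapply g x) -> ~ grid q (param g) -> move_delta g x = 0 ->
  cells_linked (idx x) (idx (uapply g x)).
Proof.
move=> Ax Agx ngx nggx ngg g0.
have gE := mvto_uapply g x.
have cxy : move_cell (is_reflection g) (idx x) (idx (uapply g x)) (idx (param g))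
    (x, uapply g x).
  by split=> /=; rewrite ?gE; exact: ngrid_cell.
apply: (cells_linked_of_germs (p0 := (x, uapply g x)) _ cxy) => -[u v] cuv /=.
have [/= cu cv cs] := cuv; set h := mvto (is_reflection g) u v.
pose D := cell (idx x) `&` uapply h @^-1` cell (idx (uapply g x)).
have Du : D u by split=> //=; rewrite mvtoE.
exists D; split=> //; first apply: open_intervalI.
- exact: open_interval_cell.
- by apply: open_interval_preimage; exact: open_interval_cell.
- by exists u.
apply: initial_gam.
- apply: open_intervalI.
  + exact: open_interval_cell.
  + by apply: open_interval_preimage; exact: open_interval_cell.
  + by exists u.
- move=> z [cz /= chz]; split; first exact: (cell_sub_domain Ax ngx).
  exact: (cell_sub_domain Agx nggx).
- left=> z [cz /= chz].
  have hE : mvto (is_reflection g) z (uapply h z) = h.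
    by rewrite -[X in mvto X](is_reflection_mvto (is_reflection g) u v) mvto_uapply.
  rewrite -hE; apply: (@move_cell_zero (is_reflection g) _ _ _ _ (z, uapply h z) cxy).
    by split=> //=; rewrite hE.
  by rewrite /= gE.
Qed.

Lemma at_right_affine (t : R) : exists al ga, \forall s \near t^'+, pi s = al * s + ga.
Proof.
have [al [ga h]] := pi_affine (idx t); exists al, ga; near=> s; apply: h.
have ts : t < s by near: s; exact: nbhs_right_gt.
have st : s < ((idx t)%:~R + 1) / q%:R.
  near: s; apply: nbhs_right_lt; rewrite ltr_pdivlMr//.
  by have := floorD1_gt (t * q%:R); rewrite intrD.
apply/andP; split; last by rewrite -ltr_pdivlMr.
by apply: (le_lt_trans (floor_le (t * q%:R))); rewrite ltr_pM2r.
Unshelve. all: by end_near. Qed.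

Lemma at_left_affine (t : R) : exists al ga, \forall s \near t^'-, pi s = al * s + ga.
Proof.
(* The cell just left of [t], also when [t] is a grid point. *)
have [al [ga h]] := pi_affine (Num.ceil (t * q%:R) - 1).
exists al, ga; near=> s; apply: h.
have ts : s < t by near: s; exact: nbhs_left_lt.
have st : (Num.ceil (t * q%:R) - 1)%:~R / q%:R < s.
  by near: s; apply: nbhs_left_gt; rewrite ltr_pdivrMr// gt_pred_ceil.
apply/andP; split; first by rewrite -ltr_pdivrMr.
rewrite intrB subrK; apply: lt_le_trans (ceil_ge (t * q%:R)).
by rewrite ltr_pM2r.
Unshelve. all: by end_near. Qed.

(* [move_delta (mv b t) z] with the value of pi at the parameter t replaced
   by V, typically a one-sided limit. *)
Definition move_delta_lim (b : bool) (t V z : R) : R :=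
  if b then pi z + pi (t - z) - V else pi z + V - pi (z + t).

Lemma move_delta_limE (b : bool) t z :
  move_delta (mv b t) z = move_delta_lim b t (pi t) z.
Proof. by case: b => //=; rewrite /delta addrCA subrr addr0. Qed.

(** Only the value of [pi] at the parameter feels the side of approach; the other varying argument
    stays in one cell. *)
Lemma move_delta_cvg (F : set_system R) {FF : ProperFilter F} (b : bool) (t al ga z : R) :
  F `=>` nbhs t -> (\forall s \near F, pi s = al * s + ga) ->
  ~ grid q (uapply (mv b t) z) ->
  move_delta (mv b s) z @[s --> F] --> move_delta_lim b t (al * t + ga) z.
Proof.
move=> Ft Faff ngz; have cz := ngrid_cell q_gt0 ngz.
have [s2 [c2 h2]] := pi_affine (idx (uapply (mv b t) z)).
have near_t : \forall s \near t, cell (idx (uapply (mv b t) z)) (uapply (mv b s) z).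
  have h : uapply (mv b s) z @[s --> t] --> uapply (mv b t) z.
    case: (b) => /=.
      by apply: cvgB; [exact: cvg_id|exact: cvg_cst].
    by apply: cvgD; [exact: cvg_cst|exact: cvg_id].
  exact: h _ (cell_near q_gt0 cz).
pose k := if b then s2 - al else al - s2.
pose l := if b then pi z - s2 * z + c2 - ga else pi z + ga - s2 * z - c2.
have -> : move_delta_lim b t (al * t + ga) z = k * t + l.
  rewrite /k /l; move: (h2 _ cz); case: (b) => /= ->; ring.
have lin : k * s + l @[s --> F] --> k * t + l.
  by apply: cvgD; [apply: cvgM; [exact: cvg_cst|exact: Ft]|exact: cvg_cst].
apply: cvg_trans lin; apply: near_eq_cvg.
apply: filterS (filterI Faff (Ft _ near_t)) => s [/= sF /h2 s2E].
rewrite move_delta_limE /k /l; move: s2E; rewrite sF.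
by case: (b) => /= ->; ring.
Qed.

(** For a grid parameter the image of the cell is a cell, so with [V] fixed the expression is affine
    in its last variable and the extrapolation argument applies on the cell. *)
Lemma move_delta_lim_zero (b : bool) t V x z : grid q t -> ~ grid q x ->
  cell (idx x) z -> (forall y, cell (idx x) y -> 0 <= move_delta_lim b t V y) ->
  move_delta_lim b t V x = 0 -> move_delta_lim b t V z = 0.
Proof.
move=> gt /(ngrid_cell q_gt0) cx cz ge0 x0.
have gg : grid q (param (mv b t)) by case: (b).
have [a' a'P] := cell_uapply q_gt0 (idx x) gg.
have [s1 [c1 h1]] := pi_affine (idx x); have [s2 [c2 h2]] := pi_affine a'.
have [al [be aff]] : exists al be, forall y, cell (idx x) y ->
    move_delta_lim b t V y = al * y + be.
  case: (b) a'P => /= a'P.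
    exists (s1 - s2), (c1 + c2 + s2 * t - V) => y cy.
    by rewrite h1// h2 ?a'P//; [ring|exact/a'P].
  exists (s1 - s2), (c1 - c2 - s2 * t + V) => y cy.
  by rewrite h1// h2 ?a'P//; [ring|exact/a'P].
have near_e : \forall e \near 0^'+, cell (idx x) (x - e * (z - x)) /\ 0 < e.
  near=> e; split; last by near: e; exact: nbhs_right_gt.
  by near: e; exact: cell_near_line.
have [e [ce e0]] := @filter_ex _ _ (at_right_proper_filter 0) _ near_e.
have := ge0 _ ce; have := ge0 _ cz; rewrite !aff// in x0 *; move=> z0.
rewrite (_ : _ + be = (1 + e) * (al * x + be) - e * (al * z + be)); last by ring.
rewrite x0 mulr0 sub0r oppr_ge0 pmulr_rle0// => z1.
by apply/eqP; rewrite eq_le z0 z1.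
Unshelve. all: by end_near. Qed.

(** The one-sided limit of the slack exists on the whole cell and is nonnegative, so its zero at [x]
    spreads, with the same side for all points. *)
Lemma one_sided_cell (F : set_system R) {FF : ProperFilter F} (b : bool) (t x : R) :
  F `=>` nbhs t -> (exists al ga, \forall s \near F, pi s = al * s + ga) ->
  grid q t -> ~ grid q x -> move_delta (mv b s) x @[s --> F] --> (0 : R) ->
  forall z, cell (idx x) z -> move_delta (mv b s) z @[s --> F] --> (0 : R).
Proof.
move=> Ft [al [ga aff]] gt ngx x0 z cz.
have gg : grid q (param (mv b t)) by case: (b).
have lim y : cell (idx x) y ->
    move_delta (mv b s) y @[s --> F] --> move_delta_lim b t (al * t + ga) y.
  move=> cy; apply: move_delta_cvg => // /(grid_uapply q_gt0 gg).
  exact: cell_ngrid cy.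
suff <- : move_delta_lim b t (al * t + ga) z = 0 by exact: lim.
apply: (@move_delta_lim_zero b t _ x) => // [y /lim h|].
  by apply: (cvgr_to_ge h); apply: nearW => s; exact: move_delta_ge0.
by apply: (@cvg_unique _ (@Rhausdorff R) _ _ _ _ (lim x (ngrid_cell q_gt0 ngx)) x0).
Qed.

(** Off the grid [pi] is affine around [t], so a one-sided limit of the slack is its value. *)
Lemma one_sided_ngrid (F : set_system R) {FF : ProperFilter F} (b : bool) (t x : R) :
  F `=>` nbhs t -> ~ grid q t -> ~ grid q (uapply (mv b t) x) ->
  move_delta (mv b s) x @[s --> F] --> (0 : R) -> move_delta (mv b t) x = 0.
Proof.
move=> Ft /(ngrid_cell q_gt0) ct ngx x0; have [al [ga aff]] := pi_affine (idx t).
have near_t : \forall s \near t, pi s = al * s + ga.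
  by apply: filterS (cell_near q_gt0 ct) => s /aff.
rewrite move_delta_limE (aff _ ct).
apply: (@cvg_unique _ (@Rhausdorff R) _ _ _ _ _ x0); apply: move_delta_cvg => //.
exact: Ft _ near_t.
Qed.

Lemma at_right_nbhs (t : R) : t^'+ `=>` nbhs t.
Proof. exact: cvg_within. Qed.

Lemma at_left_nbhs (t : R) : t^'- `=>` nbhs t.
Proof. exact: cvg_within. Qed.

(** An off-grid parameter reduces to an exact zero, which links the cells. For a grid parameter the
    exact or one-sided zero spreads over the cell of [x], making [g] an initial move there. *)
Lemma initial_move_good g D : initial_move pi g D -> good_on q A Gam g D.
Proof.
move=> [oD DA gDA gD] x Dx; have Ax := DA _ Dx.
have Agx : A (uapply g x) by apply: gDA; exists x.
split=> // ngx nggx.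
have gE := mv_param g.
have {gD} : move_delta g x = 0 \/
    (move_delta (mv (is_reflection g) s) x @[s --> (param g)^'+] --> (0 : R) \/
     move_delta (mv (is_reflection g) s) x @[s --> (param g)^'-] --> (0 : R)).
  by case: (g) gD => t /= [_ [h|h]]; [left|right|left|right]; exact: h.
have [gg|ngg] := EM (grid q (param g)); last first.
  move=> h; left; apply: delta_zero_linked => //.
  case: h => [//|[h|h]]; rewrite -gE.
  - by apply: (one_sided_ngrid (@at_right_nbhs _) ngg _ h); rewrite gE.
  - by apply: (one_sided_ngrid (@at_left_nbhs _) ngg _ h); rewrite gE.
move=> h; right; split=> // y cy; exists (cell (idx x)); split=> //.
  exact: open_interval_cell.
apply: initial_gam; first exact: open_interval_cell.
  move=> z cz; split; first exact: (cell_sub_domain Ax ngx).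
  apply: (cell_sub_domain Agx nggx).
  by rewrite -cell_uapply_idx.
case: h => [h|[h|h]].
- left=> z cz; move: h; rewrite -gE !move_delta_limE => h.
  apply: (move_delta_lim_zero gg ngx cz _ h) => w _.
  by rewrite -move_delta_limE; exact: move_delta_ge0.
- right=> z cz; left.
  exact: (one_sided_cell (@at_right_nbhs _) (at_right_affine _) gg ngx h).
- right=> z cz; right.
  exact: (one_sided_cell (@at_left_nbhs _) (at_left_affine _) gg ngx h).
Qed.

Lemma clsemi_initial_good : Gam `<=` good_moves q A Gam.
Proof.
have GmP := good_moves_closed q_gt0 GamP.
apply: smallest_sub => // m [[g ->]|[g [D [gD ->]]]|[g [D [gD ->]]]].
- by apply/good_movesP; split=> //; right.
- by apply/good_movesP; split; [left; case: gD|exact: initial_move_good].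
- have [[_ _ inv] _] := GmP; apply: inv; apply/good_movesP.
  by split; [left; case: gD|exact: initial_move_good].
Qed.

End InitialMoves.

Theorem theorem9p15 (R : realType) (f : R) (pi : R -> R)
    (n : nat) (x : nat -> R) (q : nat)
    (f_nonint : f \isn't a Num.int)
    (pi_min : minimal_valid f pi)
    (x_sub : subdivision n x)
    (pi_pwl : piecewise_linear (breakpoints n x) pi)
    (q_gt0 : (0 < q)%N)
    (B_grid : breakpoints n x `<=` @grid R q) :
  let A := continuity_domain pi in
  let Gam := clsemi A (initial_ensemble pi) in
  let G01 := @grid R q `&` `[0, 1]%classic in
  exists (W : set (tagged_map R)) (C : set (set R)),
    [/\ finite_presentation Gam W C,
        reduced_form Gam W C,
        (forall (g : umove R) (D : set R), open_interval D -> W (restr g D) ->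
           endpoints_in G01 D /\ (@grid R q `&` param_range g) (param g))
      & (forall U J : set R, C U -> maximal_interval U J ->
           endpoints_in G01 J)].
Proof.
move=> A Gam G01.
have aff := piecewise_linear_cell x_sub q_gt0 pi_pwl B_grid.
have [_ [delta_ge0 _]] := pi_min.
apply: (grid_finite_presentation q_gt0 (clsemi_initial_closed pi)).
- exact: clsemi_initial_good.
- exact: continuity_domain_open.
- exact: continuity_domain_sub01.
Qed.
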